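(* Let $H$ and $K$ be complex infinite-dimensional separable Hilbert spaces, and let $A\in B(H)$, $B\in B(K)$. Then for each $\sigma_{*}\in\{\sigma_{r},\sigma_{SF-},\sigma_{sw}\}$, $$\bigcap_{C\in \Phi(K,H)}\sigma_{*}(M_{C})=\Big(\bigcap_{C\in B(K,H)}\sigma_{*}(M_{C})\Big)\cup \{\lambda\in \mathbb{C}: A-\lambda \text{ is compact}\}.$$
   Context: $B(H,K)$ is the set of bounded linear operators from $H$ to $K$, and $B(H)=B(H,H)$. For $T\in B(H,K)$, $N(T)$ and $R(T)$ are its kernel and range, $\alpha(T)=\dim N(T)$ and $\beta(T)=\dim (K/R(T))$, with values in $\{0,1,2,\dots\}\cup\{\infty\}$. $T$ is upper semi-Fredholm if $R(T)$ is closed and $\alpha(T)<\infty$; lower semi-Fredholm if $\beta(T)<\infty$; semi-Fredholm if it is either, in which case $\mathrm{ind}(T)=\alpha(T)-\beta(T)\in\mathbb{Z}\cup\{\pm\infty\}$; Fredholm if it is semi-Fredholm with $\alpha(T)<\infty$ and $\beta(T)<\infty$. $\Phi(K,H)$ denotes the set of Fredholm operators from $K$ to $H$. A lower semi-Weyl operator is a lower semi-Fredholm operator with $\mathrm{ind}\ge 0$. For an operator $T$ on a Hilbert space: $\sigma_r(T)$, $\sigma_{SF-}(T)$, $\sigma_{sw}(T)$ are the sets of $\lambda\in\mathbb{C}$ such that $T-\lambda I$ is not right invertible, not lower semi-Fredholm, not lower semi-Weyl, respectively. $T-\lambda$ means $T-\lambda I$. For $C\in B(K,H)$, $M_C=\begin{pmatrix}A&C\\0&B\end{pmatrix}\in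 B(H\oplus K)$, i.e. $M_C(x,y)=(Ax+Cy,By)$. *)

(* Defs.v *)
From HB Require Import structures.
From mathcomp Require Import all_boot all_order all_algebra sesquilinear.
From mathcomp Require Import all_classical all_reals all_analysis.
From mathcomp Require Import ring.
From mathcomp.real_closed Require Import complex.

Set Implicit Arguments.
Unset Strict Implicit.
Unset Printing Implicit Defensive.

Import Order.TTheory GRing.Theory Num.Theory.
Import numFieldNormedType.Exports.

Local Open Scope classical_set_scope.
Local Open Scope ring_scope.

(* The scalar field is left general (algebraically closed, with a
   conjugation); complex Hilbert spaces are obtained at [R[i]], R : realType.
   The norm of a normed module over C is itself C-valued. *)
HB.mixin Record isHilbert (C : numClosedFieldType) V
    & CompleteNormedModule C V := {
  inner : {dot V for Num.conj} ;
  inner_norm : forall x : V, inner x x = `|x| ^+ 2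
}.

#[short(type="hilbertType")]
HB.structure Definition Hilbert (C : numClosedFieldType) :=
  {V of CompleteNormedModule C V & isHilbert C V}.

HB.mixin Record isBoundedMap (K : numFieldType) (V W : normedModType K)
    (f : V -> W) := {
  bounded_map : exists M : K, forall x, `|f x| <= M * `|x|
}.

HB.structure Definition BoundedLinear (K : numFieldType)
    (V W : normedModType K) :=
  {f of isBoundedMap K V W f & @GRing.Linear K V W *:%R f}.

Notation "''B' ( V , W )" := (@BoundedLinear.type _ V W)
  (at level 8, format "''B' ( V ,  W )") : ring_scope.

(* H ⊕ K; the alias replaces the max norm of the product by the Hilbert one *)
Definition hsum (C : numClosedFieldType) (H K : hilbertType C) : Type :=
  (H * K)%type.

Section HilbertSum.
Variables (C : numClosedFieldType) (H K : hilbertType C).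

HB.instance Definition _ := GRing.Lmodule.copy (hsum H K) (H * K)%type.

Definition hsum_norm (z : hsum H K) : C :=
  sqrtC (`|z.1| ^+ 2 + `|z.2| ^+ 2).

Lemma hsum_norm2 z : hsum_norm z ^+ 2 = `|z.1| ^+ 2 + `|z.2| ^+ 2.
Proof. by rewrite /hsum_norm sqrtCK. Qed.

Lemma hsum_norm_ge0 z : 0 <= hsum_norm z.
Proof. by rewrite sqrtC_ge0 addr_ge0 ?exprn_ge0. Qed.

Lemma hsum_normD x y : hsum_norm (x + y) <= hsum_norm x + hsum_norm y.
Proof.
rewrite -(@ler_pXn2r _ 2) ?nnegrE ?addr_ge0 ?hsum_norm_ge0//.
have [p2 q2] := (hsum_norm2 x, hsum_norm2 y).
have [p0 q0] := (hsum_norm_ge0 x, hsum_norm_ge0 y).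
rewrite hsum_norm2 sqrrD p2 q2 /=.
move: (hsum_norm x) (hsum_norm y) p2 q2 p0 q0 => p q p2 q2 p0 q0.
apply: (@le_trans _ _ ((`|x.1| + `|y.1|) ^+ 2 + (`|x.2| + `|y.2|) ^+ 2)).
  by rewrite lerD// ler_pXn2r ?nnegrE ?addr_ge0 ?ler_normD.
have cs : `|x.1| * `|y.1| + `|x.2| * `|y.2| <= p * q.
  rewrite -(@ler_pXn2r _ 2) ?nnegrE ?addr_ge0 ?mulr_ge0//.
  rewrite exprMn p2 q2 -subr_ge0.
  set d := (X in 0 <= X).
  have -> : d = (`|x.1| * `|y.2| - `|x.2| * `|y.1|) ^+ 2 by rewrite /d; ring.
  by rewrite -realEsqr rpredB ?rpredM ?normr_real.
rewrite -subr_ge0.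
set d := (X in 0 <= X).
have -> : d = (p * q - (`|x.1| * `|y.1| + `|x.2| * `|y.2|)) *+ 2.
  by rewrite /d; ring.
by rewrite mulrn_wge0 ?subr_ge0.
Qed.

Lemma hsum_normZ (l : C) x : hsum_norm (l *: x) = `|l| * hsum_norm x.
Proof.
apply/eqP; rewrite -(@eqrXn2 _ 2) ?mulr_ge0 ?hsum_norm_ge0//.
by rewrite exprMn !hsum_norm2 /= !normrZ !exprMn mulrDr.
Qed.

Lemma hsum_norm0_eq0 x : hsum_norm x = 0 -> x = 0.
Proof.
move=> x0; have := hsum_norm2 x; rewrite x0 expr0n/= => /esym/eqP.
rewrite paddr_eq0 ?exprn_ge0// !expf_eq0/= !normr_eq0.
by case: x {x0} => a b /= /andP[/eqP -> /eqP ->].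
Qed.

HB.instance Definition _ := Lmodule_isNormed.Build C (hsum H K)
  hsum_normD hsum_normZ hsum_norm0_eq0.

Lemma hsum_normE (z : hsum H K) : `|z| = hsum_norm z. Proof. by []. Qed.

Lemma hsum_norm_fst (z : hsum H K) : `|z.1| <= `|z|.
Proof.
rewrite -(@ler_pXn2r _ 2) ?nnegrE// hsum_normE hsum_norm2 lerDl.
by rewrite exprn_ge0.
Qed.

Lemma hsum_norm_snd (z : hsum H K) : `|z.2| <= `|z|.
Proof.
rewrite -(@ler_pXn2r _ 2) ?nnegrE// hsum_normE hsum_norm2 lerDr.
by rewrite exprn_ge0.
Qed.

Lemma hsum_norm_le (z : hsum H K) : `|z| <= `|z.1| + `|z.2|.
Proof.
rewrite -(@ler_pXn2r _ 2) ?nnegrE ?addr_ge0//.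
rewrite hsum_normE hsum_norm2 sqrrD lerD2r lerDl.
by rewrite mulrn_wge0// mulr_ge0.
Qed.

Lemma hsum_complete (F : set_system (hsum H K)) :
  ProperFilter F -> cauchy F -> cvg F.
Proof.
move=> FF /(cauchyP F) Fc.
have proj_cvg (V : hilbertType C) (f : {linear hsum H K -> V}) :
    (forall z, `|f z| <= `|z|) -> cvg (f @ F).
  move=> f1; apply: cauchy_cvg; apply/(cauchyP (f @ F)) => e e0.
  have [x Fx] := Fc e e0; exists (f x).
  change (F (f @^-1` ball (f x) e)).
  apply: filterS Fx => y; rewrite /= -!ball_normE /=.
  rewrite [X in _ -> `|X| < _](_ : _ = f (x - y)); last by rewrite raddfB.
  exact: le_lt_trans.
have lin1 : linear (fst : hsum H K -> H) by [].
have lin2 : linear (snd : hsum H K -> K) by [].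
pose m1 := GRing.isLinear.Build _ _ _ _ (fst : hsum H K -> H) lin1.
pose m2 := GRing.isLinear.Build _ _ _ _ (snd : hsum H K -> K) lin2.
pose f1 : {linear hsum H K -> H} := HB.pack (fst : hsum H K -> H) m1.
pose f2 : {linear hsum H K -> K} := HB.pack (snd : hsum H K -> K) m2.
have /cvg_ex[/= l1 /cvgrPdist_lt l1P] := proj_cvg _ f1 hsum_norm_fst.
have /cvg_ex[/= l2 /cvgrPdist_lt l2P] := proj_cvg _ f2 hsum_norm_snd.
apply/cvg_ex; exists ((l1, l2) : hsum H K); apply/cvgrPdist_lt => e e0.
have e2 : 0 < e / 2 by rewrite divr_gt0.
near=> z.
rewrite (le_lt_trans (hsum_norm_le _))// (splitr e) ltrD//=; near: z.
- exact: l1P.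
- exact: l2P.
Unshelve. all: by end_near. Qed.

HB.instance Definition _ := Uniform_isComplete.Build (hsum H K) hsum_complete.

Definition hsum_inner (x y : hsum H K) : C :=
  inner x.1 y.1 + inner x.2 y.2.

Lemma hsum_inner_bilinear :
  bilinear_for *%R (Num.conj \; *%R) hsum_inner.
Proof.
split=> [y a u v|x a u v]; rewrite /hsum_inner /=.
- by rewrite !linearPl/= mulrDr addrACA.
- by rewrite !linearPr/= mulrDr addrACA.
Qed.

HB.instance Definition _ := bilinear_isBilinear.Build C (hsum H K) (hsum H K) C
  *%R (Num.conj \; *%R) hsum_inner hsum_inner_bilinear.

Lemma hsum_inner_herm x y :
  hsum_inner x y = (-1) ^+ false * (hsum_inner y x)^*.
Proof.
by rewrite expr0 mul1r /hsum_inner rmorphD/= !(hermitian_subproof x.1)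
  !(hermitian_subproof x.2) !expr0 !mul1r.
Qed.

HB.instance Definition _ := isHermitianSesquilinear.Build C (hsum H K)
  false Num.conj hsum_inner hsum_inner_herm.

Lemma hsum_innerE x : hsum_inner x x = `|x| ^+ 2.
Proof. by rewrite /hsum_inner !inner_norm hsum_normE hsum_norm2. Qed.

Lemma hsum_inner_gt0 x : x != 0 -> 0 < hsum_inner x x.
Proof. by move=> x0; rewrite hsum_innerE exprn_gt0 ?normr_gt0. Qed.

HB.instance Definition _ := isDotProduct.Build C (hsum H K)
  hsum_inner hsum_inner_gt0.

HB.instance Definition _ := isHilbert.Build C (hsum H K) hsum_innerE.

End HilbertSum.

Section Operators.
Variable C : numClosedFieldType.

Definition sub_scalar (V : normedModType C) (T : 'B(V, V)) (lambda : C) (x : V) : V :=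
  T x - lambda *: x.

Section SubScalar.
Variables (V : normedModType C) (T : 'B(V, V)) (lambda : C).

Lemma sub_scalar_linear : linear (sub_scalar T lambda).
Proof.
move=> a x y; rewrite /sub_scalar linearP scalerBr scalerDr !scalerA.
by rewrite opprD addrACA (mulrC a).
Qed.

HB.instance Definition _ := GRing.isLinear.Build C V V *:%R (sub_scalar T lambda)
  sub_scalar_linear.

Lemma sub_scalar_bounded : exists M : C, forall x, `|sub_scalar T lambda x| <= M * `|x|.
Proof.
have [M TM] := bounded_map (s := T).
exists (M + `|lambda|) => x; rewrite mulrDl -normrZ.
by rewrite (le_trans (ler_normB _ _))// lerD2r.
Qed.

HB.instance Definition _ := isBoundedMap.Build C V V (sub_scalar T lambda)
  sub_scalar_bounded.
End SubScalar.

Definition upper_triangular (H K : hilbertType C) (A : 'B(H, H)) (B : 'B(K, K))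
    (D : 'B(K, H)) (z : hsum H K) : hsum H K :=
  (A z.1 + D z.2, B z.2).

Section UpperTriangular.
Variables (H K : hilbertType C) (A : 'B(H, H)) (B : 'B(K, K)) (D : 'B(K, H)).

Lemma upper_triangular_linear : linear (upper_triangular A B D).
Proof.
move=> a x y; rewrite /upper_triangular /= !linearP.
by congr pair => /=; rewrite scalerDr addrACA.
Qed.

HB.instance Definition _ := GRing.isLinear.Build C (hsum H K) (hsum H K) *:%R
  (upper_triangular A B D) upper_triangular_linear.

Lemma upper_triangular_bounded :
  exists M : C, forall z, `|upper_triangular A B D z| <= M * `|z|.
Proof.
have [a Aa] := bounded_map (s := A).
have [b Bb] := bounded_map (s := B).
have [d Dd] := bounded_map (s := D).
have ge (V W : normedModType C) (T : 'B(V, W)) M :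
    (forall x, `|T x| <= M * `|x|) -> forall x e, `|x| <= e ->
    `|T x| <= `|M| * e.
  move=> TM x e xe; rewrite -[leLHS]normr_id.
  have h : 0 <= M * `|x| by rewrite (le_trans _ (TM x)).
  rewrite normr_id (le_trans (TM x))// -(ger0_norm h) normrM normr_id.
  by rewrite ler_wpM2l.
exists (`|a| + `|d| + `|b|) => z; rewrite (le_trans (hsum_norm_le _))//=.
rewrite !mulrDl lerD//; last by apply: ge Bb _ _ (hsum_norm_snd z).
rewrite (le_trans (ler_normD _ _))// lerD//.
  exact: ge Aa _ _ (hsum_norm_fst z).
exact: ge Dd _ _ (hsum_norm_snd z).
Qed.

HB.instance Definition _ := isBoundedMap.Build C (hsum H K) (hsum H K)
  (upper_triangular A B D) upper_triangular_bounded.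
End UpperTriangular.

(* For subspaces W `<=` U: the classes of e 0, ..., e (n - 1) form a basis of
   U / W. *)
Definition quotient_basis (V : lmodType C) (U W : set V) n (e : 'I_n -> V) :=
  (forall i, U (e i)) /\
  forall x, U x -> exists! c : 'rV[C]_n, W (x - \sum_i c 0 i *: e i).

(* The size of a finite basis of U / W (unique when it exists), else +oo. *)
Definition quotient_dim (V : lmodType C) (U W : set V) : \bar int :=
  xget +oo%E
    [set (n%:Z)%:E%E | n in [set n | exists e : 'I_n -> V, quotient_basis U W e]].

Definition vdim (V : lmodType C) (U : set V) := quotient_dim U [set 0].

Section Fredholm.
Variables V W : normedModType C.
Implicit Types T : 'B(V, W).
Local Open Scope ereal_scope.

Definition nullity T : \bar int := vdim (T @^-1` [set 0%R]).
Definition defect T : \bar int := quotient_dim [set: W] (range T).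
Definition upper_semiFredholm T := closed (range T) /\ nullity T < +oo.
Definition lower_semiFredholm T := defect T < +oo.
Definition semiFredholm T := upper_semiFredholm T \/ lower_semiFredholm T.
(* Only meaningful for a semi-Fredholm operator: [+oo - +oo] is a dummy. *)
Definition fredholm_index T : \bar int := nullity T - defect T.
Definition Fredholm T := [/\ semiFredholm T, nullity T < +oo & defect T < +oo].
Definition lower_semiWeyl T := lower_semiFredholm T /\ 0%R%:E <= fredholm_index T.
Definition right_invertible T := exists S : 'B(W, V), forall y, T (S y) = y.
Definition compact_operator T := precompact (T @` [set x | (`|x| <= 1)%R]).
End Fredholm.

Definition sigma_r (V : hilbertType C) (T : 'B(V, V)) : set C :=
  [set lambda | ~ right_invertible (sub_scalar T lambda)].
Definition sigma_SFminus (V : hilbertType C) (T : 'B(V, V)) : set C :=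
  [set lambda | ~ lower_semiFredholm (sub_scalar T lambda)].
Definition sigma_sw (V : hilbertType C) (T : 'B(V, V)) : set C :=
  [set lambda | ~ lower_semiWeyl (sub_scalar T lambda)].

End Operators.

Definition separable (T : topologicalType) :=
  exists2 D : set T, countable D & dense D.

(* Main.v *)
Require Import Defs.
From HB Require Import structures.
From mathcomp Require Import all_boot all_order all_algebra sesquilinear.
From mathcomp Require Import all_classical all_reals all_analysis.
From mathcomp Require Import ring lra.
From mathcomp.real_closed Require Import complex.
Set Implicit Arguments.
Unset Strict Implicit.
Unset Printing Implicit Defensive.
Import Order.TTheory GRing.Theory Num.Theory.
Import numFieldNormedType.Exports.
Local Open Scope classical_set_scope.
Local Open Scope complex_scope.
Local Open Scope ring_scope.

(** Write A, B for A - lambda, B - lambda, and M_D for the operator matrix with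
    corner D.  Each of the three properties behind the spectra (surjectivity,
    which for bounded operators on these spaces is right invertibility; finite
    defect; finite defect with index at least 0) is read off from the range, the
    defect and the index of M_D.  So the theorem amounts to two facts.

    If A is compact and D is Fredholm, then M_D has infinite defect
    ([compact_corner_not_finite_defect]).  Suppose not.  By the open mapping
    theorem, each k in the unit ball of K satisfies
    (0, k) = M_D (x, y) + f with x, y, f bounded and f in a fixed
    finite-dimensional space.  Then D y = - A x - f_1 ranges over a totally
    bounded set, hence so does y because D is Fredholm, hence so does
    k = B y + f_2: the unit ball of K would be totally bounded.

    If A is not compact and some M_{D0} has finite defect, then D0 can be
    replaced by a Fredholm D such that M_D is at least as good as M_{D0}
    ([noncompact_corner_improvement]).
    - If N(B) is finite-dimensional, take for D a Fredholm operator which agrees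
      with D0 on N(B).  Then D - D0 = G B for a linear map G, so that M_D is
      M_{D0} followed by the bijection (x, y) |-> (x + G y, y): the defect, the
      nullity and surjectivity do not change.
    - If N(B) is infinite-dimensional, non-compactness provides a bounded
      orthogonal sequence t_n which A maps to an orthonormal sequence u_n.
      Take for D a unitary operator which maps a sequence p in N(B) onto a basis
      of the complement of the even terms u_{2n}, and the complement of p onto the
      closed span of these u_{2n}.  The terms u_{2n} are reached by A, their
      complement by D on N(B), so the range of M_D is H (+) R(B), the largest
      possible; and each odd term u_{2n+1} is reached in both ways, so the kernel
      of M_D is infinite-dimensional and the index is +oo.

    The projections and unitary operators in these proofs are sums of diagonal
    operators x |-> sum_n <x, e_n> f_n along two orthogonal sequences
    ([diagonal_operator]); orthonormal bases come from Gram-Schmidt applied to a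
    dense sequence ([exists_basis]), which is where separability enters. *)

(** * Scalars and inner products *)

Section Scalars.
Variable R : realType.
Implicit Types (x e M : R[i]) (a : nat -> R[i]).

Lemma complex_archi x : exists n : nat, `|x| < n%:R.
Proof.
have /complex_realP[r ->] := normr_real x.
have [n rn] : exists n : nat, r < n%:R.
  by exists (Num.truncn r).+1; exact: truncnS_gt.
by exists n; rewrite -[n%:R](rmorph_nat (real_complex R)) ltcR.
Qed.

Lemma invSn_small e : 0 < e -> exists n : nat, n.+1%:R^-1 < e.
Proof.
move=> e0; have [n en] := complex_archi e^-1; exists n.
rewrite -[ltRHS]invrK ltf_pV2 ?posrE ?invr_gt0//.
rewrite -(ger0_norm (ltW _ : 0 <= e^-1)) ?invr_gt0//.
by rewrite (lt_trans en)// ltr_nat.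
Qed.

Lemma expV2_small e : 0 < e -> exists n : nat, 2^-1 ^+ n < e.
Proof.
move=> /invSn_small[n ne]; exists n; apply: le_lt_trans ne.
rewrite exprVn lef_pV2 ?posrE ?exprn_gt0//.
by rewrite -natrX ler_nat ltn_expl.
Qed.

(** The scalar field is complex, with a partial order; the supremum of the partial
    sums is taken on real parts. *)
Lemma bounded_series_cauchy a M : (forall i, 0 <= a i) ->
    (forall n, \sum_(0 <= i < n) a i <= M) ->
  forall e, 0 < e -> exists N : nat, forall m n : nat, (N <= m)%N -> (m <= n)%N ->
    \sum_(m <= i < n) a i < e.
Proof.
move=> a0 aM e e0.
pose s n := complex.Re (\sum_(0 <= i < n) a i).
have sE n : (s n)%:C = \sum_(0 <= i < n) a i.
  by rewrite RRe_real// ger0_real// sumr_ge0.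
have hs : has_sup (range s).
  split; first by exists (s 0%N); exists 0%N.
  exists (complex.Re M) => _ [n _ <-]; have := aM n.
  by rewrite -sE lecE => /andP[].
have eE : (complex.Re e)%:C = e by rewrite RRe_real// ger0_real// ltW.
have re0 : 0 < complex.Re e by rewrite -ltcR eE.
have [_ [N _ <-] sN] := sup_adherent re0 hs.
exists N => m n Nm mn.
have -> : \sum_(m <= i < n) a i = (s n - s m)%:C.
  by rewrite rmorphB/= !sE (big_cat_nat (leq0n m) mn)//= addrAC subrr add0r.
rewrite -eE ltcR.
have sn : s n <= sup (range s) by apply: ub_le_sup; [exact: hs.2 | exists n].
have sm : s N <= s m.
  by rewrite -lecR !sE (big_cat_nat (leq0n N) Nm)//= lerDl sumr_ge0.
by rewrite ltrBlDr (le_lt_trans sn)// -ltrBlDl (lt_le_trans sN).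
Qed.

End Scalars.

Section InnerProduct.
Variables (R : realType) (V : hilbertType R[i]).
Implicit Types (x y z : V) (c : R[i]).

Lemma innerC x y : inner x y = (inner y x)^*%R.
Proof. by rewrite (hermitian_subproof x y) expr0 mul1r. Qed.

Lemma innerDl x y z : inner (x + y) z = inner x z + inner y z.
Proof. exact: linearDl. Qed.
Lemma innerDr x y z : inner z (x + y) = inner z x + inner z y.
Proof. exact: linearDr. Qed.
Lemma innerBl x y z : inner (x - y) z = inner x z - inner y z.
Proof. exact: linearBl. Qed.
Lemma innerBr x y z : inner z (x - y) = inner z x - inner z y.
Proof. exact: linearBr. Qed.
Lemma innerZl c x y : inner (c *: x) y = c * inner x y.
Proof. exact: linearZl_LR. Qed.
Lemma innerZr c x y : inner x (c *: y) = (c^*)%R * inner x y.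
Proof. exact: linearZr_LR. Qed.
Lemma inner0l x : inner 0 x = 0. Proof. exact: linear0l. Qed.
Lemma inner0r x : inner x 0 = 0. Proof. exact: linear0r. Qed.
Lemma inner_suml I r (P : pred I) (F : I -> V) x :
  inner (\sum_(i <- r | P i) F i) x = \sum_(i <- r | P i) inner (F i) x.
Proof. exact: linear_sumlz. Qed.
Lemma inner_sumr I r (P : pred I) (F : I -> V) x :
  inner x (\sum_(i <- r | P i) F i) = \sum_(i <- r | P i) inner x (F i).
Proof. exact: linear_sumr. Qed.

Lemma inner_eq0C x y : inner x y = 0 -> inner y x = 0.
Proof. by move=> xy; rewrite innerC xy rmorph0. Qed.

Lemma norm2D_orth x y : inner x y = 0 ->
  `|x + y| ^+ 2 = `|x| ^+ 2 + `|y| ^+ 2.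
Proof. by move=> xy; rewrite -!inner_norm hnormDd. Qed.

Lemma norm_le2 x y : `|x| ^+ 2 <= `|y| ^+ 2 -> `|x| <= `|y|.
Proof. by rewrite ler_pXn2r ?nnegrE. Qed.

Lemma cauchy_schwarz x y : `|inner x y| <= `|x| * `|y|.
Proof.
have [->|y0] := eqVneq y 0; first by rewrite inner0r normr0 mulr_ge0.
have ny : 0 < `|y| ^+ 2 by rewrite exprn_gt0 ?normr_gt0.
pose a := inner x y / `|y| ^+ 2.
have ort : inner (x - a *: y) (a *: y) = 0.
  by rewrite innerZr innerBl innerZl inner_norm divfK ?gt_eqF// subrr mulr0.
have := norm2D_orth ort; rewrite subrK => nx.
have : `|a *: y| ^+ 2 <= `|x| ^+ 2 by rewrite nx lerDr exprn_ge0.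
rewrite normrZ normrM normfV (ger0_norm (ltW ny)) exprMn => h.
rewrite -(@ler_pXn2r _ 2) ?nnegrE ?mulr_ge0// exprMn -ler_pdivrMr//.
apply: le_trans h; rewrite exprMn -mulrA ler_wpM2l ?exprn_ge0//.
by rewrite (expr2 (_ ^-1)) -mulrA mulVf ?mulr1 ?gt_eqF.
Qed.

End InnerProduct.

(** * Convergent sequences and bounded maps *)

Section Sequences.
Variable R : realType.

Lemma cauchy_seq_cvg (V : completeNormedModType R[i]) (u : nat -> V) :
    (forall e : R[i], 0 < e -> exists N : nat, forall m n : nat,
      (N <= m)%N -> (m <= n)%N -> `|u n - u m| < e) ->
  exists l : V, u @ \oo --> l.
Proof.
move=> uC; suff: cvg (u @ \oo) by move/cvg_ex.
apply: cauchy_cvg; apply: cauchy_exP => e e0.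
have [N uN] := uC e e0; exists (u N); exists N => // n /= Nn.
by rewrite -ball_normE /= distrC uN.
Qed.

Lemma seq_cvgP (V : normedModType R[i]) (u : nat -> V) (l : V) :
  u @ \oo --> l <-> forall e : R[i], 0 < e -> exists N : nat, forall n : nat,
    (N <= n)%N -> `|l - u n| < e.
Proof.
split=> [/cvgrPdist_lt ul e e0|ul].
  by have [N _ uN] := ul e e0; exists N => n Nn; exact: uN.
by apply/cvgrPdist_lt => e e0; have [N uN] := ul e e0; exists N.
Qed.

Lemma cvg_seq_unique (V : normedModType R[i]) (u : nat -> V) (l l' : V) :
  u @ \oo --> l -> u @ \oo --> l' -> l = l'.
Proof. exact: norm_cvg_unique. Qed.

(** The order of the complex numbers is partial, so the usual epsilon argument
    needs both sides to be real. *)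
Lemma ler_of_gt0 (x y : R[i]) : x \is Num.real -> y \is Num.real ->
  (forall e, 0 < e -> x <= y + e) -> x <= y.
Proof.
move=> xr yr h; case: (real_leP xr yr) => // yx.
have e0 : 0 < (x - y) / 2 by rewrite divr_gt0// subr_gt0.
have := h _ e0; rewrite -lerBlDl ler_pdivlMr// mulr_natr mulr2n gerDl.
by move/le_gtF; rewrite subr_gt0 yx.
Qed.

Lemma cvg_seq_norm_le (V : normedModType R[i]) (u : nat -> V) (l : V) (r : R[i]) :
  u @ \oo --> l -> (forall n, `|u n| <= r) -> `|l| <= r.
Proof.
move=> /seq_cvgP ul ur; apply: ler_of_gt0; rewrite ?normr_real//.
  by rewrite ger0_real// (le_trans _ (ur 0%N)).
move=> e e0; have [N /(_ N (leqnn N)) uN] := ul e e0.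
rewrite -[l](subrK (u N)) (le_trans (ler_normD _ _))// addrC lerD//.
exact: ltW.
Qed.

Lemma bounded_map_pos (V W : normedModType R[i]) (T : 'B(V, W)) :
  exists2 M : R[i], 0 < M & forall x, `|T x| <= M * `|x|.
Proof.
have [M TM] := bounded_map (s := T); exists (`|M| + 1).
  by rewrite ltr_wpDl.
move=> x; have h : 0 <= M * `|x| by rewrite (le_trans _ (TM x)).
rewrite (le_trans (TM x))// -(ger0_norm h) normrM normr_id.
by rewrite ler_wpM2r// lerDl.
Qed.

Lemma bounded_map_cvg (V W : normedModType R[i]) (T : 'B(V, W)) (u : nat -> V) (l : V) :
  u @ \oo --> l -> (fun n => T (u n)) @ \oo --> T l.
Proof.
move=> /seq_cvgP ul; apply/seq_cvgP => e e0.
have [M M0 TM] := bounded_map_pos T.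
have [N uN] := ul (e / M) (divr_gt0 e0 M0); exists N => n /uN h.
by rewrite -linearB (le_lt_trans (TM _))// mulrC -ltr_pdivlMr.
Qed.

Lemma bounded_linear_pack (V W : normedModType R[i]) (f : V -> W) (M : R[i]) :
  linear f -> (forall x, `|f x| <= M * `|x|) -> exists T : 'B(V, W), T =1 f.
Proof.
move=> lf bf.
pose m1 := GRing.isLinear.Build _ _ _ *:%R f lf.
pose m2 := isBoundedMap.Build _ _ _ f (ex_intro _ M bf).
by exists (HB.pack_for 'B(V, W) f m1 m2).
Qed.

Lemma bounded_combination (V W : normedModType R[i]) (S T : 'B(V, W)) (a : R[i]) :
  exists D : 'B(V, W), forall x, D x = S x + a *: T x.
Proof.
have [s s0 sP] := bounded_map_pos S; have [t t0 tP] := bounded_map_pos T.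
have [||D DE] := @bounded_linear_pack V W (fun x => S x + a *: T x) (s + `|a| * t).
- move=> c x y; rewrite [S _]linearP [T _]linearP/= scalerDr addrACA scalerDr.
  by rewrite !scalerA mulrC.
- move=> x; rewrite (le_trans (ler_normD _ _))// mulrDl lerD// normrZ -mulrA.
  by rewrite ler_wpM2l.
by exists D.
Qed.

Lemma cvg_inner_l (V : hilbertType R[i]) (u : nat -> V) (l y : V) (c : R[i]) :
  u @ \oo --> l -> (exists N : nat, forall n : nat, (N <= n)%N -> inner (u n) y = c) ->
  inner l y = c.
Proof.
move=> /seq_cvgP ul [N uc]; apply/eqP; rewrite -subr_eq0 -normr_le0.
apply: ler_of_gt0; rewrite ?normr_real// => e e0; rewrite add0r.
have y0 : 0 < `|y| + 1 by rewrite ltr_wpDl.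
have [N' uN] := ul (e / (`|y| + 1)) (divr_gt0 e0 y0).
have := uN _ (leq_maxr N N'); rewrite -(uc _ (leq_maxl N N')) -innerBl => h.
rewrite (le_trans (cauchy_schwarz _ _))//.
rewrite -[leRHS](divfK (_ : `|y| + 1 != 0)).
  by rewrite ler_pM// ?lerDl// ltW.
by rewrite gt_eqF.
Qed.

End Sequences.

(** * Orthogonal sequences and diagonal operators *)

Section Orthogonal.
Variable R : realType.
Implicit Types V W : hilbertType R[i].

Definition orthogonal_seq V (e : nat -> V) :=
  forall i j, i != j -> inner (e i) (e j) = 0.

Lemma orthogonal_seq_lt V (e : nat -> V) :
  (forall n i, (i < n)%N -> inner (e n) (e i) = 0) -> orthogonal_seq e.
Proof.
move=> eo i j; rewrite neq_ltn => /orP[ij|ji]; last exact: eo.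
by apply: inner_eq0C; exact: eo.
Qed.

Lemma norm2_orthogonal_sum V (f : nat -> V) (c : nat -> R[i]) m n :
  orthogonal_seq f ->
  `|\sum_(m <= i < n) c i *: f i| ^+ 2 = \sum_(m <= i < n) `|c i| ^+ 2 * `|f i| ^+ 2.
Proof.
move=> fo; case: (leqP m n) => mn; last by rewrite !big_geq ?normr0 ?expr0n// ltnW.
rewrite -(subnKC mn); elim: (n - m)%N => [|k IHk].
  by rewrite addn0 !big_geq ?normr0 ?expr0n.
rewrite addnS !big_nat_recr ?leq_addr//= norm2D_orth ?IHk.
  by rewrite normrZ exprMn.
rewrite inner_suml big_nat_cond big1// => i /andP[/andP[_ ik] _].
by rewrite innerZl innerZr fo ?mulr0// ltn_eqF.
Qed.

Definition expansion V (W : lmodType R[i]) (e : nat -> V) (f : nat -> W) (x : V)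
  (n : nat) : W := \sum_(0 <= i < n) inner x (e i) *: f i.

Lemma inner_expansion V W (e : nat -> V) (f : nat -> W) x n : orthogonal_seq f ->
  forall k, (k < n)%N ->
  inner (expansion e f x n) (f k) = inner x (e k) * `|f k| ^+ 2.
Proof.
move=> fo k kn; rewrite /expansion inner_suml.
rewrite (bigD1_seq k) ?iota_uniq ?mem_index_iota//=.
rewrite innerZl inner_norm big1 ?addr0// => i ik.
by rewrite innerZl fo ?mulr0.
Qed.

(** Norms at most 1, instead of equal to 1, allow sequences that contain zeros,
    and so finite families padded with zeros. *)
Lemma bessel V (e : nat -> V) x n : orthogonal_seq e -> (forall i, `|e i| <= 1) ->
  \sum_(0 <= i < n) `|inner x (e i)| ^+ 2 <= `|x| ^+ 2.
Proof.
move=> eo e1; pose s := \sum_(0 <= i < n) inner x (e i) *: e i.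
have sx : inner s x = \sum_(0 <= i < n) `|inner x (e i)| ^+ 2.
  by rewrite inner_suml; apply: eq_bigr => i _; rewrite innerZl [inner (e i) x]innerC normCK.
have ss : `|s| ^+ 2 <= \sum_(0 <= i < n) `|inner x (e i)| ^+ 2.
  rewrite norm2_orthogonal_sum//; apply: ler_sum => i _.
  by rewrite ler_piMr ?exprn_ge0// exprn_ile1.
have : 0 <= `|x - s| ^+ 2 by rewrite exprn_ge0.
rewrite -inner_norm innerBl !innerBr [inner x s]innerC sx !inner_norm.
rewrite rmorph_sum/=.
under [X in _ - X - _]eq_bigr do rewrite rmorphXn/= conj_normC.
set S := \sum_(_ <= _ < _) _ in ss * => h.
rewrite -subr_ge0 (le_trans h)// opprB gerDl.
by rewrite subr_le0.
Qed.

(** By Pythagoras, the square of the norm of a block of the series is at most M^2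
    times a block of the Bessel series, so the series is Cauchy. *)
Lemma diagonal_operator V W (e : nat -> V) (f : nat -> W) (M : R[i]) :
    orthogonal_seq e -> (forall i, `|e i| <= 1) ->
    orthogonal_seq f -> (forall i, `|f i| <= M) ->
  exists T : 'B(V, W), forall x, expansion e f x @ \oo --> T x.
Proof.
move=> eo e1 fo fM.
have M0 : 0 <= M by rewrite (le_trans _ (fM 0%N)).
have fM2 i : `|f i| ^+ 2 <= M ^+ 2 by rewrite ler_pXn2r ?nnegrE.
have tail x m n : `|\sum_(m <= i < n) inner x (e i) *: f i| ^+ 2 <=
    M ^+ 2 * \sum_(m <= i < n) `|inner x (e i)| ^+ 2.
  rewrite norm2_orthogonal_sum// mulr_sumr; apply: ler_sum => i _.
  by rewrite mulrC ler_wpM2r// exprn_ge0.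
have ex_lim x : exists l : W, expansion e f x @ \oo --> l.
  apply: cauchy_seq_cvg => d d0.
  have d1 : 0 < d ^+ 2 / (M ^+ 2 + 1).
    by rewrite divr_gt0 ?exprn_gt0// ltr_wpDl// exprn_ge0.
  have [N hN] := bounded_series_cauchy (a := fun i => `|inner x (e i)| ^+ 2)
    (fun i => exprn_ge0 2 (normr_ge0 _)) (fun n => bessel x n eo e1) d1.
  exists N => m n Nm mn.
  rewrite /expansion (big_cat_nat (leq0n m) mn)/= addrAC subrr add0r.
  rewrite -(@ltr_pXn2r _ 2) ?nnegrE ?(ltW d0)//.
  apply: le_lt_trans (tail x m n) _.
  have := hN m n Nm mn; rewrite ltr_pdivlMr ?ltr_wpDl ?exprn_ge0//.
  apply: le_lt_trans; rewrite mulrC ler_wpM2l ?lerDl//.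
  by rewrite sumr_ge0// => i _; rewrite exprn_ge0.
have [T TP] := boolp.choice ex_lim.
suff [T' T'E] : exists T' : 'B(V, W), T' =1 T.
  by exists T' => x; rewrite T'E; exact: TP.
apply: (@bounded_linear_pack _ _ _ _ M).
  move=> a x y; apply: (cvg_seq_unique (TP _)).
  have -> : expansion e f (a *: x + y) =
      (fun n => a *: expansion e f x n + expansion e f y n).
    apply/funext => n; rewrite /expansion scaler_sumr -big_split/=.
    by apply: eq_bigr => i _; rewrite innerDl innerZl scalerDl scalerA.
  by apply: cvgD; [apply: cvgZr; exact: TP|exact: TP].
move=> x; apply: (cvg_seq_norm_le (TP x)) => n.
rewrite -(@ler_pXn2r _ 2) ?nnegrE ?mulr_ge0//.
rewrite (le_trans (tail x 0%N n))// exprMn ler_wpM2l ?exprn_ge0//.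
exact: bessel.
Qed.

End Orthogonal.

Definition linear_subspace (C : numFieldType) (V : lmodType C) (N : set V) :=
  N 0 /\ forall a x y, N x -> N y -> N (a *: x + y).

Lemma linear_subspaceB (C : numFieldType) (V : lmodType C) (N : set V) x y :
  linear_subspace N -> N x -> N y -> N (x - y).
Proof. by move=> [_ Nl] Nx Ny; rewrite -scaleN1r addrC; exact: Nl. Qed.

Section Diagonal.
Variable R : realType.
Implicit Types U V W : hilbertType R[i].

(** Stated as a relation between a function and two sequences, so that it is
    preserved by composition with a bounded map ([diagonal_comp]) and determines
    the function ([diagonal_unique]): identities between operators are reduced to
    identities between sequences. *)
Definition diagonal V W (e : nat -> V) (f : nat -> W) (T : V -> W) :=
  forall x, expansion e f x @ \oo --> T x.

(** Zeros are allowed so that closed subspaces of finite and of infinite dimension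
    have bases indexed in the same way, by all natural numbers. *)
Definition semi_orthonormal V (e : nat -> V) :=
  orthogonal_seq e /\ forall n, e n = 0 \/ `|e n| = 1.

Definition orthonormal_seq V (e : nat -> V) :=
  orthogonal_seq e /\ forall n, `|e n| = 1.

(** For a closed subspace N and a semi-orthonormal e, this says that e is an
    orthonormal basis of N, up to zeros. *)
Definition complete_in V (N : set V) (e : nat -> V) :=
  (forall n, N (e n)) /\ forall x, N x -> (forall n, inner x (e n) = 0) -> x = 0.

Definition seq_closed V (N : set V) :=
  forall (u : nat -> V) (l : V), (forall n, N (u n)) -> u @ \oo --> l -> N l.

Definition orthocomplement V (e : nat -> V) : set V :=
  [set x | forall n, inner x (e n) = 0].

Lemma orthonormal_semi V (e : nat -> V) : orthonormal_seq e -> semi_orthonormal e.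
Proof. by move=> [eo e1]; split=> // n; right. Qed.

Lemma orthonormal_sub V (e : nat -> V) (s : nat -> nat) :
  injective s -> orthonormal_seq e -> orthonormal_seq (e \o s).
Proof. by move=> si [eo e1]; split=> [i j ij|n]; [apply: eo; rewrite inj_eq|exact: e1]. Qed.

Lemma semi_orthonormal_le1 V (e : nat -> V) : semi_orthonormal e ->
  forall n, `|e n| <= 1.
Proof. by move=> [_ e1] n; case: (e1 n) => ->; rewrite ?normr0. Qed.

Lemma semi_orthonormal_operator V W (e : nat -> V) (f : nat -> W) :
  semi_orthonormal e -> semi_orthonormal f -> exists T : 'B(V, W), diagonal e f T.
Proof.
move=> eS fS; apply: (@diagonal_operator _ _ _ _ _ 1) fS.1 _; first exact: eS.1.
  exact: semi_orthonormal_le1.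
exact: semi_orthonormal_le1.
Qed.

Lemma inner_semi V (e : nat -> V) x n : semi_orthonormal e ->
  inner x (e n) * `|e n| ^+ 2 = inner x (e n).
Proof.
by move=> [_ /(_ n)[->|->]]; rewrite ?inner0r ?mul0r// expr1n mulr1.
Qed.

Section DiagonalTheory.
Variables (V W : hilbertType R[i]) (e : nat -> V) (f : nat -> W) (T : V -> W).
Hypothesis TD : diagonal e f T.

Lemma diagonal_unique T' : diagonal e f T' -> T =1 T'.
Proof. by move=> T'D x; exact: cvg_seq_unique (@TD x) (T'D x). Qed.

Lemma diagonal_comp U (L : 'B(W, U)) :
  diagonal e (fun n => L (f n)) (fun x => L (T x)).
Proof.
move=> x; suff -> : expansion e (fun n => L (f n)) x =
    (fun n => L (expansion e f x n)) by exact: bounded_map_cvg (@TD x).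
apply/funext => n.
by rewrite /expansion linear_sum; apply: eq_bigr => i _; rewrite linearZ.
Qed.

Lemma diagonal_eq0 x : (forall n, inner x (e n) *: f n = 0) -> T x = 0.
Proof.
move=> h; apply: (cvg_seq_unique (@TD x)); apply/seq_cvgP => d d0.
exists 0%N => n _; rewrite /expansion big1 => [|i _]; last exact: h.
by rewrite subr0 normr0.
Qed.

Lemma diagonal_basis k : orthogonal_seq e -> T (e k) = `|e k| ^+ 2 *: f k.
Proof.
move=> eo; apply: (cvg_seq_unique (@TD _)); apply/seq_cvgP => d d0.
exists k.+1 => n kn; rewrite /expansion (bigD1_seq k) ?iota_uniq ?mem_index_iota//=.
rewrite inner_norm big1 ?addr0 ?subrr ?normr0// => i ik.
by rewrite eo 1?eq_sym// scale0r.
Qed.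

Lemma diagonal_finite m x : (forall n, (m <= n)%N -> e n = 0) ->
  T x = \sum_(0 <= i < m) inner x (e i) *: f i.
Proof.
move=> em; apply: (cvg_seq_unique (@TD x)); apply/seq_cvgP => d d0; exists m => n mn.
rewrite /expansion (big_cat_nat (leq0n _) mn)/= [X in _ - (_ + X)]big_nat_cond.
rewrite [X in _ - (_ + X)]big1; first by rewrite addr0 subrr normr0.
by move=> i /andP[/andP[mi _] _]; rewrite em// inner0r scale0r.
Qed.

Lemma diagonal_inner x k : orthogonal_seq f ->
  inner (T x) (f k) = inner x (e k) * `|f k| ^+ 2.
Proof.
move=> fo; apply: (cvg_inner_l (@TD x)); exists k.+1 => n kn.
exact: inner_expansion.
Qed.

Lemma diagonal_mem (N : set W) x : linear_subspace N -> seq_closed N ->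
  (forall n, N (f n)) -> N (T x).
Proof.
move=> [N0 Nl] Nc fN; apply: Nc (@TD x) => n; rewrite /expansion.
elim: n => [|n IHn]; first by rewrite big_geq.
by rewrite big_nat_recr//= addrC; exact: Nl.
Qed.

Lemma diagonal_inner0 x y : (forall n, inner (f n) y = 0) -> inner (T x) y = 0.
Proof.
move=> fy; apply: (cvg_inner_l (@TD x)); exists 0%N => n _.
by rewrite /expansion inner_suml big1// => i _; rewrite innerZl fy mulr0.
Qed.

End DiagonalTheory.

Lemma diagonal_compose U V W (e : nat -> U) (f : nat -> V) (g : nat -> W)
    (S : U -> V) (T : 'B(V, W)) (P : U -> W) :
    orthonormal_seq f -> diagonal e f S -> diagonal f g T -> diagonal e g P ->
  forall x, T (S x) = P x.
Proof.
move=> [fo f1] SD TD PD; apply: diagonal_unique PD.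
suff E : (fun n => T (f n)) = g by have := diagonal_comp SD (L := T); rewrite E.
by apply/funext => n; rewrite (diagonal_basis TD)// f1 expr1n scale1r.
Qed.

Section Projection.
Variables (V : hilbertType R[i]) (e : nat -> V) (P : 'B(V, V)).
Hypotheses (eS : semi_orthonormal e) (PD : diagonal e e P).

(** The diagonal operator from e to e is the orthogonal projection onto the closed
    span of e. *)
Lemma projection_orth x n : inner (x - P x) (e n) = 0.
Proof.
by rewrite innerBl (diagonal_inner PD) ?inner_semi ?subrr//; exact: eS.1.
Qed.

Lemma projection_norm2 x : `|x| ^+ 2 = `|x - P x| ^+ 2 + `|P x| ^+ 2.
Proof.
rewrite -norm2D_orth ?subrK//; apply: inner_eq0C.
by apply: (diagonal_inner0 PD) => k; apply: inner_eq0C; exact: projection_orth.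
Qed.

Lemma projection_le x : `|P x| <= `|x|.
Proof. by apply: norm_le2; rewrite [leRHS]projection_norm2 lerDr exprn_ge0. Qed.

Lemma projection_rest_le x : `|x - P x| <= `|x|.
Proof. by apply: norm_le2; rewrite [leRHS]projection_norm2 lerDl exprn_ge0. Qed.

Lemma projection_id (N : set V) x : linear_subspace N -> seq_closed N ->
  complete_in N e -> N x -> P x = x.
Proof.
move=> Nl Nc [eN e0] xN; apply/esym/eqP; rewrite -subr_eq0; apply/eqP.
apply: e0; last by move=> n; exact: projection_orth.
apply: linear_subspaceB => //; exact: (diagonal_mem PD).
Qed.

End Projection.

Lemma orthocomplement_linear V (e : nat -> V) : linear_subspace (orthocomplement e).
Proof.
split=> [n|a x y xe ye n]; first exact: inner0l.
by rewrite innerDl innerZl xe ye mulr0 addr0.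
Qed.

Lemma kernel_linear V W (T : 'B(V, W)) : linear_subspace [set x | T x = 0].
Proof.
split=> [|a x y /= Tx Ty]; first exact: linear0.
by rewrite linearP/= Tx Ty scaler0 addr0.
Qed.

Lemma kernel_closed V W (T : 'B(V, W)) : seq_closed [set x | T x = 0].
Proof.
move=> u l uT ul /=; apply: (cvg_seq_unique (bounded_map_cvg (T := T) ul)).
apply/seq_cvgP => d d0; exists 0%N => n _.
by rewrite (uT n) subr0 normr0.
Qed.

End Diagonal.

(** * Orthonormal bases of closed subspaces *)

(** Recursion in which each term may depend on the list of all earlier ones. *)
Lemma sequence_by_history (T : Type) (F : nat -> seq T -> T) :
  exists e : nat -> T, forall n, e n = F n (mkseq e n).
Proof.
pose fix g n := if n is m.+1 then rcons (g m) (F m (g m)) else [::].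
exists (fun n => F n (g n)) => n; congr (F n _).
elim: n => [//|n IHn] /=.
by rewrite mkseqS -IHn.
Qed.

Section Bases.
Variable R : realType.
Implicit Types V W : hilbertType R[i].

Lemma subspace_sum V (N : set V) (I : Type) (r : seq I) (c : I -> R[i]) (v : I -> V) :
  linear_subspace N -> (forall i, N (v i)) -> N (\sum_(i <- r) c i *: v i).
Proof.
move=> [N0 Nl] Nv; elim: r => [|i r IHr]; first by rewrite big_nil.
by rewrite big_cons; exact: Nl.
Qed.

(** A vector d n that depends on its predecessors gives e n = 0 instead of being
    skipped; this keeps the indices aligned, and a list padded with zeros gives a
    finite orthonormal family padded with zeros. *)
Lemma gram_schmidt V (d : nat -> V) : exists e : nat -> V,
  [/\ semi_orthonormal e, forall n, d n = 0 -> e n = 0,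
      forall x, (forall n, inner x (e n) = 0) -> forall n, inner x (d n) = 0 &
      forall N : set V, linear_subspace N -> (forall n, N (d n)) -> forall n, N (e n)].
Proof.
(* the inverse of 0 is 0, so nrm 0 = 0 *)
pose nrm (r : V) := `|r|^-1 *: r.
pose res n (s : seq V) := d n - \sum_(v <- s) inner (d n) v *: v.
have [e eE] := sequence_by_history (fun n s => nrm (res n s)).
pose r n := d n - \sum_(0 <= i < n) inner (d n) (e i) *: e i.
have {}eE n : e n = nrm (r n).
  rewrite eE /res /mkseq big_map; congr (nrm (_ - _)).
  by rewrite /index_iota subn0.
have nrm01 x : nrm x = 0 \/ `|nrm x| = 1.
  have [->|x0] := eqVneq x 0; first by left; rewrite /nrm scaler0.
  right; rewrite /nrm normrZ normfV normr_id mulVf ?normr_eq0//.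
have e1 n : e n = 0 \/ `|e n| = 1 by rewrite eE.
have rE x : x = `|x| *: nrm x.
  have [->|x0] := eqVneq x 0; first by rewrite /nrm !scaler0.
  by rewrite /nrm scalerA mulfV ?scale1r// normr_eq0.
have eo : orthogonal_seq e.
  apply: orthogonal_seq_lt => n; elim/ltn_ind: n => n IHn i i_n.
  rewrite (eE n) /nrm innerZl.
  suff -> : inner (r n) (e i) = 0 by rewrite mulr0.
  rewrite /r innerBl inner_suml (bigD1_seq i) ?iota_uniq ?mem_index_iota//=.
  rewrite innerZl inner_norm big_seq_cond big1 => [|j].
    by case: (e1 i) => ->; rewrite ?inner0r ?mul0r ?addr0 ?subrr// expr1n mulr1 subrr.
  rewrite mem_index_iota /= => /andP[jn ji]; rewrite innerZl.
  suff -> : inner (e j) (e i) = 0 by rewrite mulr0.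
  move: ji; rewrite neq_ltn => /orP[ji|ij]; first by apply: inner_eq0C; exact: IHn.
  exact: IHn.
exists e; split=> //.
- move=> n dn; rewrite eE /r dn big1 ?subr0 => [|i _]; first by rewrite /nrm scaler0.
  by rewrite inner0l scale0r.
- move=> x xe n; suff -> : d n = `|r n| *: e n + \sum_(0 <= i < n) inner (d n) (e i) *: e i.
    rewrite innerDr innerZr xe mulr0 add0r inner_sumr big1// => i _.
    by rewrite innerZr xe mulr0.
  by rewrite eE -rE /r subrK.
- move=> N Nl Nd n; elim/ltn_ind: n => n IHn.
  have Ns : N (\sum_(0 <= i < n) inner (d n) (e i) *: e i).
    rewrite big_seq; elim/big_rec: _ => [|i x]; first exact: Nl.1.
    by rewrite mem_index_iota /= => i_n Nx; apply: Nl.2 => //; exact: IHn.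
  rewrite eE /nrm -[_ *: _]addr0; apply: Nl.2 Nl.1.
  exact: linear_subspaceB.
Qed.

(** A subset of a separable space is separable, although it need not meet the
    given countable dense set: for each point of that set and each radius 1/(m+1),
    pick a point of N in the ball if there is one. *)
Lemma dense_sequence V (N : set V) : separable V -> N 0 ->
  exists d : nat -> V, (forall n, N (d n)) /\
    forall x, N x -> forall e : R[i], 0 < e -> exists n, `|x - d n| < e.
Proof.
move=> [D /countable_injP[g g_inj] Dd] N0.
pose good (k : nat) (y : V) := if unpickle k is Some (n, m)
  then forall x z, D z -> g z = n -> N x -> `|x - z| < m.+1%:R^-1 ->
    N y /\ `|y - z| < m.+1%:R^-1 :> R[i] else True.
have ex_good k : exists y, N y /\ good k y.
  rewrite /good; case: (unpickle k) => [[n m]|]; last by exists 0.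
  have [[x [z [Dz gz Nx xz]]]|no] := pselect (exists x z,
      [/\ D z, g z = n, N x & `|x - z| < m.+1%:R^-1 :> R[i]]).
    exists x; split=> // x' z' Dz' gz' _ _.
    suff -> : z' = z by [].
    by apply: g_inj; rewrite ?inE// gz gz'.
  exists 0; split=> // x z Dz gz Nx xz; exfalso; apply: no.
  by exists x, z.
have [d dP] := boolp.choice ex_good.
exists d; split=> [n|x Nx e e0]; first exact: (dP n).1.
have [m me] := invSn_small (divr_gt0 e0 (ltr0Sn _ 1)).
have m0 : 0 < m.+1%:R^-1 :> R[i] by rewrite invr_gt0 ltr0Sn.
have [z [xz Dz]] : (ball x (m.+1%:R^-1 : R[i])) `&` D !=set0.
  apply: Dd; last exact: ball_open.
  by exists x; exact: ballxx.
rewrite -ball_normE /= in xz.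
exists (pickle (g z, m)).
have := (dP (pickle (g z, m))).2; rewrite /good pickleK.
move=> /(_ x z Dz erefl Nx xz)[_ dz].
rewrite -(subrK z x) -addrA (le_lt_trans (ler_normD _ _))//.
rewrite (splitr e) ltrD// ?(lt_trans xz me)// distrC.
exact: lt_trans me.
Qed.

(** Gram-Schmidt on a dense sequence d of N: an x in N orthogonal to the result is
    orthogonal to all d n, so |x|^2 = <x, x - d n> <= |x| |x - d n|, which is
    absurd for d n close to x unless x = 0. *)
Lemma exists_basis V (N : set V) : separable V -> linear_subspace N ->
  exists2 e : nat -> V, semi_orthonormal e & complete_in N e.
Proof.
move=> sV Nl; have [d [Nd dd]] := dense_sequence sV Nl.1.
have [e [eS _ ed eN]] := gram_schmidt d.
exists e => //; split; first exact: eN.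
move=> x Nx xe; apply/eqP/negP => /negP x0.
have nx : 0 < `|x| by rewrite normr_gt0.
have [n xn] := dd x Nx _ nx.
have : `|x| * `|x| <= `|x| * `|x - d n|.
  rewrite -expr2 -inner_norm -[inner x x]subr0 -(ed x xe n) -innerBr.
  rewrite -[leLHS]ger0_norm ?cauchy_schwarz//.
  by rewrite innerBr (ed x xe n) subr0 inner_norm exprn_ge0.
by rewrite ler_pM2l// => /le_gtF; rewrite xn.
Qed.

(** Removes the zeros of a semi-orthonormal sequence with infinitely many nonzero
    terms; needed to pair two bases term by term in a unitary operator. *)
Lemma nonzero_enum V (e : nat -> V) : semi_orthonormal e ->
    (forall m, exists2 n, (m <= n)%N & e n != 0) ->
  exists e' : nat -> V, [/\ orthonormal_seq e', forall n, exists m, e' n = e m &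
    forall n, e n != 0 -> exists m, e n = e' m].
Proof.
move=> [eo e1] einf.
pose S := [set n | e n != 0].
have : ([set: nat] #= S)%card.
  rewrite card_eq_sym; apply: eq_card_nat => //.
  move=> /finite_seqP[s sE].
  have [n sn en] := einf (\max_(i <- s) i).+1.
  have ns : n \in s by have : S n := en; rewrite sE.
  by move: sn; rewrite ltnNge => /negP; apply; exact: (leq_bigmax_seq (F := id)).
move/card_set_bijP => [s [sS s_inj s_surj]].
have s0 n : e (s n) != 0 by exact: sS.
exists (e \o s); split.
- split=> [i j ij|n] /=; last by case: (e1 (s n)) => // /eqP; rewrite (negPf (s0 n)).
  apply: eo; apply: contra ij => /eqP ij; apply/eqP; apply: s_inj => //; exact: in_setT.
- by move=> n; exists (s n).
- by move=> n en; have [m _ <-] := s_surj n en; exists m.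
Qed.

(** The hypothesis is a form of infinite dimension adapted to orthogonality: a
    finite list never exhausts N. *)
Lemma exists_orthonormal_basis V (N : set V) : separable V -> linear_subspace N ->
    (forall s : seq V, exists2 x, N x &
      x != 0 /\ forall v, v \in s -> inner x v = 0) ->
  exists2 e : nat -> V, orthonormal_seq e & complete_in N e.
Proof.
move=> sV Nl Ninf; have [e eS [eN ec]] := exists_basis sV Nl.
have [m|e' [e'O e'e ee']] := nonzero_enum eS.
  apply: contrapT => nom.
  have [x Nx [x0 xe]] := Ninf (mkseq e m).
  move/eqP: x0; apply; apply: ec => // n.
  have [nm|mn] := ltnP n m; first by apply: xe; rewrite map_f ?mem_iota.
  have [->|en] := eqVneq (e n) 0; first exact: inner0r.
  by exfalso; apply: nom; exists n.
exists e' => //; split=> [n|x Nx xe']; first by have [m ->] := e'e n.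
apply: ec => // n; have [->|/ee'[m ->]] := eqVneq (e n) 0; last exact: xe'.
exact: inner0r.
Qed.

End Bases.

(** * Totally bounded families *)

Section TotallyBounded.
Variable R : realType.

(** Total boundedness of the image of S under g, phrased on the index set: S can be
    coloured by finitely many colours such that g varies by less than e on each
    colour.  In this form, transfer to another family whose increments are
    controlled ([totally_bounded_lift]) only takes the product of two colourings,
    and no centres have to be chosen. *)
Definition totally_bounded_on (I : Type) (V : normedModType R[i]) (S : set I)
    (g : I -> V) :=
  forall e : R[i], 0 < e -> exists (F : finType) (color : I -> F),
    forall x y, S x -> S y -> color x = color y -> `|g x - g y| < e.

Lemma totally_bounded_lift (I : Type) (U V W : normedModType R[i]) (S : set I)
    (g : I -> U) (h : I -> V) (k : I -> W) (M : R[i]) : 0 < M ->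
    totally_bounded_on S g -> totally_bounded_on S h ->
    (forall x y, S x -> S y -> `|k x - k y| <= M * (`|g x - g y| + `|h x - h y|)) ->
  totally_bounded_on S k.
Proof.
move=> M0 gS hS kS e e0.
have d0 : 0 < e / M / 2 by rewrite !divr_gt0.
have [F [c cP]] := gS _ d0; have [F' [c' cP']] := hS _ d0.
exists (F * F')%type, (fun x => (c x, c' x)) => x y Sx Sy [cxy cxy'].
apply: le_lt_trans (kS x y Sx Sy) _.
rewrite mulrC -ltr_pdivlMr// (splitr (e / M)) ltrD//; [exact: cP|exact: cP'].
Qed.

Lemma totally_bounded_reindex (I J : Type) (V : normedModType R[i]) (S : set I)
    (T : set J) (g : I -> V) (f : J -> I) : (forall j, T j -> S (f j)) ->
  totally_bounded_on S g -> totally_bounded_on T (g \o f).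
Proof.
move=> fT gS e /gS[F [c cP]]; exists F, (c \o f) => x y Tx Ty; apply: cP; exact: fT.
Qed.

(** The colour of x is its cell in a grid of step 1/(k+1). *)
Lemma real_coloring (M : R) (k : nat) : exists (F : finType) (color : R -> F),
  forall x y, `|x| <= M -> `|y| <= M -> color x = color y -> `|x - y| < k.+1%:R^-1.
Proof.
pose p (x : R) := Num.truncn ((x + M) * k.+1%:R).
pose N := Num.truncn ((M + M) * k.+1%:R).
exists 'I_N.+1, (fun x => inord (p x)) => x y xM yM.
have k0 : 0 < k.+1%:R :> R by rewrite ltr0Sn.
have px z : `|z| <= M -> 0 <= (z + M) * k.+1%:R /\ (p z <= N)%N.
  rewrite ler_norml => /andP[Mz zM]; split; first by rewrite mulr_ge0// -lerBlDr sub0r.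
  by apply: le_truncn; rewrite ler_pM2r// lerD2r.
have [x0 pxN] := px x xM; have [y0 pyN] := px y yM.
move/(congr1 val); rewrite /= !inordK ?ltnS// => pxy.
have := truncn_itv x0; have := truncn_itv y0; rewrite -/(p x) -/(p y) pxy.
move=> /andP[y1 y2] /andP[x1 x2].
rewrite -[ltRHS]mul1r ltr_pdivlMr// -(gtr0_norm k0) -normrM.
move: x1 x2 y1 y2; rewrite -[(p y).+1]addn1 natrD.
set P := (p y)%:R => x1 x2 y1 y2.
by rewrite ltr_norml; apply/andP; split; nra.
Qed.

Lemma complex_coloring (M e : R[i]) : 0 < e -> exists (F : finType) (color : R[i] -> F),
  forall x y, `|x| <= M -> `|y| <= M -> color x = color y -> `|x - y| < e.
Proof.
move=> e0; have [k ke] := invSn_small (divr_gt0 e0 (ltr0Sn _ 1)).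
have [F [c cP]] := real_coloring (complex.Re M) k.
exists (F * F)%type, (fun x => (c (complex.Re x), c (complex.Im x))).
have normRe (z : R[i]) : `|complex.Re z|%:C <= `|z|.
  exact: normc_ge_Re.
have normi : `|'i%C : R[i]| = 1.
  by rewrite normc_def/= expr0n/= add0r expr1n sqrtr1.
have normIm (z : R[i]) : `|complex.Im z|%:C <= `|z|.
  by have := normc_ge_Re (z * 'i%C); rewrite ReiNIm normrN normrM normi mulr1.
have bnd (r : R) (z : R[i]) : `|r|%:C <= `|z| -> `|z| <= M -> `|r| <= complex.Re M.
  by move=> rz zM; have := le_trans rz zM; rewrite lecE => /andP[].
move=> x y xM yM [cx cy].
have := cP _ _ (bnd _ _ (normRe x) xM) (bnd _ _ (normRe y) yM) cx.
have := cP _ _ (bnd _ _ (normIm x) xM) (bnd _ _ (normIm y) yM) cy.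
set r := complex.Im x - _; set q := complex.Re x - _ => rk qk.
have -> : x - y = q%:C + 'i%C * r%:C.
  by rewrite /q /r; case: (x) => ? ?; case: (y) => ? ?; simpc.
have normR (t : R) : `|t%:C| = `|t|%:C by rewrite normc_def/= expr0n/= addr0 sqrtr_sqr.
have tk (t : R) : `|t| < k.+1%:R^-1 -> `|t%:C| < e / 2.
  move=> tk; apply: lt_trans ke; rewrite normR.
  by rewrite -[k.+1%:R](rmorph_nat (real_complex R)) -fmorphV ltcR.
rewrite (le_lt_trans (ler_normD _ _))// normrM normi mul1r (splitr e).
by rewrite ltrD// tk.
Qed.

Lemma totally_bounded_scale (I : Type) (V : normedModType R[i]) (S : set I)
    (c : I -> R[i]) (v : V) (M : R[i]) : (forall x, S x -> `|c x| <= M) ->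
  totally_bounded_on S (fun x => c x *: v).
Proof.
move=> cM e e0; have v1 : 0 < `|v| + 1 by rewrite ltr_wpDl.
have [F [col colP]] := complex_coloring M (divr_gt0 e0 v1).
exists F, (col \o c) => x y Sx Sy cxy; rewrite -scalerBl normrZ.
have := colP _ _ (cM x Sx) (cM y Sy) cxy; rewrite ltr_pdivlMr//.
by apply: le_lt_trans; rewrite ler_wpM2l// lerDl.
Qed.

Lemma totally_bounded_sum (I : Type) (V : normedModType R[i]) (S : set I)
    (c : nat -> I -> R[i]) (v : nat -> V) (M : R[i]) n :
    (forall i x, S x -> `|c i x| <= M) ->
  totally_bounded_on S (fun x => \sum_(0 <= i < n) c i x *: v i).
Proof.
move=> cM; elim: n => [|n IHn].
  move=> e e0; exists unit, (fun=> tt) => x y _ _ _.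
  by rewrite !big_geq// subrr normr0.
apply: (totally_bounded_lift ltr01 IHn (@totally_bounded_scale _ _ _ _ (v n) _ (cM n))).
move=> x y _ _.
by rewrite !big_nat_recr//= opprD addrACA mul1r ler_normD.
Qed.

(** The colour of x is the position of the first centre close to g x in a finite
    cover by balls. *)
Lemma precompact_totally_bounded (I : Type) (V : normedModType R[i]) (S : set I)
    (g : I -> V) : precompact (g @` S) -> totally_bounded_on S g.
Proof.
rewrite precompactE compact_cover => cpt e e0.
have e2 : 0 < e / 2 by rewrite divr_gt0.
have [|v _|D _ cov] := cpt V setT (fun v => ball v (e / 2)).
- by move=> v _; exact: ball_open.
- by exists v => //; exact: ballxx.
pose near (v d : V) := `|v - d| < e / 2.
exists 'I_(size (finmap.enum_fset D)).+1,
  (fun x => inord (find (near (g x)) (finmap.enum_fset D))) => x y Sx Sy.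
have has_near z : S z -> has (near (g z)) (finmap.enum_fset D).
  move=> Sz; have /cov[d dD dz] : closure (g @` S) (g z).
    by apply: subset_closure; exists z.
  by apply/hasP; exists d; [exact: dD|move: dz; rewrite -ball_normE /near /= distrC].
move/(congr1 val); rewrite /= !inordK ?ltnS ?find_size// => xy.
have := nth_find 0 (has_near x Sx); have := nth_find 0 (has_near y Sy).
rewrite /near xy; set d := nth _ _ _ => dy dx.
rewrite -(subrK d (g x)) -addrA (le_lt_trans (ler_normD _ _))//.
by rewrite (splitr e) ltrD// distrC.
Qed.

(** An ultrafilter on the closure contains one of the finitely many thickened
    colour classes, for each e; so it is Cauchy. *)
Lemma totally_bounded_precompact (I : Type) (V : completeNormedModType R[i])
    (S : set I) (g : I -> V) : totally_bounded_on S g -> precompact (g @` S).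
Proof.
move=> gS; rewrite precompactE compact_ultra => /= F FU FS.
have FF : ProperFilter F by exact: ultra_proper.
have : cvg F.
  apply: cauchy_cvg; apply: cauchy_exP => e e0.
  have e2 : 0 < e / 2 by rewrite divr_gt0.
  have [C [color colP]] := gS _ e2.
  (* thickened by e / 2, so that the pieces cover the closure of the image *)
  pose piece c := [set y | exists x, [/\ S x, color x = c & `|g x - y| < e / 2]].
  have [c Fc] : exists c, F (piece c).
    apply: contrapT => no.
    have Fn c : F (~` piece c).
      have [Fc|//] := in_ultra_setVsetC (piece c) FU.
      by exfalso; apply: no; exists c.
    have FI : F (closure (g @` S) `&` [set y | forall c, (~` piece c) y]).
      by apply: filterI FS _; exact: filter_forall.
    have [y [yS yn]] := filter_ex FI.
    have [z [[x Sx <-]]] := yS _ (nbhsx_ballx y (e / 2) e2).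
    rewrite -ball_normE /= distrC => xy.
    by apply: (yn (color x)); exists x.
  have /filter_ex[y [x [Sx cx xy]]] := Fc.
  exists (g x); apply: filterS Fc => z [x' [Sx' cx' xz]].
  rewrite -ball_normE /= -(subrK (g x') (g x)) -addrA.
  rewrite (le_lt_trans (ler_normD _ _))// (splitr e) ltrD//.
  by apply: colP; rewrite // cx cx'.
move/cvg_ex => [l Fl]; exists l; split=> //.
by apply: (closed_cvg (u_ := id) (closure (g @` S))) Fl; first exact: closed_closure.
Qed.

End TotallyBounded.

(** * Orthogonal images under a non-compact operator *)

Section NonCompact.
Variable R : realType.
Implicit Types V W : hilbertType R[i].

(** The value at w of the adjoint of A; this is the Riesz representation of the
    functional x |-> <A x, w>, by a multiple of a vector y orthogonal to its
    kernel. *)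
Lemma adjoint_exists V W (A : 'B(V, W)) (w : W) : separable V ->
  exists z, forall x, inner (A x) w = inner x z.
Proof.
move=> sV; pose N : set V := [set x | inner (A x) w = 0].
have Nl : linear_subspace N.
  split=> [|a x y Nx Ny]; first by rewrite /N /= linear0 inner0l.
  by rewrite /N /= linearP innerDl innerZl Nx Ny mulr0 addr0.
have Nc : seq_closed N.
  move=> u l Nu ul; apply: cvg_inner_l (bounded_map_cvg (T := A) ul) _.
  by exists 0%N => n _; exact: Nu.
have [e eS eN] := exists_basis sV Nl.
have [P PD] := semi_orthonormal_operator eS eS.
have [N_all|] := pselect (forall x, N x); first by exists 0 => x; rewrite N_all inner0r.
move=> /existsNP[x0 x0N].
pose y := x0 - P x0.
have PN x : N (P x) by apply: (diagonal_mem PD) => //; exact: eN.1.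
have yN n : N n -> inner n y = 0.
  move=> Nn; rewrite -(projection_id eS PD Nl Nc eN Nn).
  apply: (diagonal_inner0 PD) => k; apply: inner_eq0C.
  exact: projection_orth.
have Ay : inner (A y) w = inner (A x0) w by rewrite linearB innerBl (PN x0) subr0.
have Ay0 : inner (A y) w != 0 by apply/eqP; rewrite Ay.
have y0 : `|y| ^+ 2 != 0.
  by rewrite expf_eq0/= normr_eq0; apply: contra_neq Ay0 => ->; rewrite linear0 inner0l.
exists (((inner (A y) w / `|y| ^+ 2)^*)%R *: y) => x.
have : N (x - (inner (A x) w / inner (A y) w) *: y).
  by rewrite /N/= linearB linearZ innerBl innerZl divfK ?subrr.
move/yN/eqP; rewrite innerBl innerZl inner_norm subr_eq0 => /eqP xy.
rewrite innerZr conjCK xy; move: y0 Ay0; set n := _ ^+ 2 => y0 Ay0.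
by field; rewrite Ay0 y0.
Qed.

(** Otherwise A is small on the orthogonal complement of some finite list, so it is
    uniformly approximated by its compositions with finite-rank projections, and
    the image of the unit ball is totally bounded. *)
Lemma noncompact_bounded_below V W (A : 'B(V, W)) : ~ compact_operator A ->
  exists2 d : R[i], 0 < d & forall s : seq V,
    exists x, [/\ forall v, v \in s -> inner x v = 0, `|x| = 1 & d <= `|A x|].
Proof.
move=> ncA; apply: contrapT => no; apply: ncA.
have small (d : R[i]) : 0 < d -> exists s : seq V, forall x,
    (forall v, v \in s -> inner x v = 0) -> `|A x| <= d * `|x|.
  move=> d0; apply: contrapT => nos; apply: no; exists d => // s.
  apply: contrapT => nox; apply: nos; exists s => x xs.
  have [->|x0] := eqVneq x 0; first by rewrite linear0 !normr0 mulr0.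
  have nx : 0 < `|x| by rewrite normr_gt0.
  have /real_leP : `|A x| \is Num.real by exact: normr_real.
  move=> /(_ (d * `|x|)); case=> //; first by rewrite ger0_real// mulr_ge0// ltW.
  move=> /ltW Ax; exfalso; apply: nox; exists (`|x|^-1 *: x); split.
  - by move=> v /xs xv; rewrite innerZl xv mulr0.
  - by rewrite normrZ normfV normr_id mulVf ?normr_eq0.
  - by rewrite linearZ normrZ normfV normr_id mulrC ler_pdivlMr.
apply: totally_bounded_precompact => e e0.
have e3 : 0 < e / 3 by rewrite divr_gt0.
have [s sP] := small _ e3.
have [b [bS b0 bs _]] := gram_schmidt (nth 0 s).
have [P PD] := semi_orthonormal_operator bS bS.
have PE x : P x = \sum_(0 <= i < size s) inner x (b i) *: b i.
  by apply: (diagonal_finite PD) => n sn; rewrite b0// nth_default.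
have rest x : `|x| <= 1 -> `|A (x - P x)| <= e / 3.
  move=> x1; apply: le_trans (sP _ _) _ => [v vs|].
    rewrite -(nth_index 0 vs); apply: bs => n; exact: projection_orth.
  by rewrite ler_piMr ?(ltW e3)// (le_trans (projection_rest_le bS PD x)).
pose S : set V := [set x | `|x| <= 1].
have tbP : totally_bounded_on S (fun x => A (P x)).
  have -> : (fun x => A (P x)) =
      (fun x => \sum_(0 <= i < size s) inner x (b i) *: A (b i)).
    apply/funext => x; rewrite PE linear_sum.
    by apply: eq_bigr => i _; rewrite linearZ.
  apply: (@totally_bounded_sum _ _ _ _ _ _ 1) => i x Sx.
  rewrite (le_trans (cauchy_schwarz _ _))// mulr_ile1//.
  exact: semi_orthonormal_le1.
have [F [c cP]] := tbP _ e3; exists F, c => x y Sx Sy cxy.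
have split3 z : A z = A (P z) + A (z - P z) by rewrite -linearD addrC subrK.
rewrite (split3 x) (split3 y) opprD addrACA.
rewrite (le_lt_trans (ler_normD _ _))//.
have -> : e = e / 3 + (e / 3 + e / 3).
  by field.
rewrite ltr_leD//; first exact: cP.
by rewrite (le_trans (ler_normB _ _))// lerD// rest.
Qed.

(** Each new x n is chosen orthogonal to the earlier x i and to the vectors
    A^* (A x_i), which makes A (x n) orthogonal to the earlier A (x i). *)
Lemma noncompact_orthogonal_seq V W (A : 'B(V, W)) : separable V ->
  ~ compact_operator A ->
  exists (x : nat -> V) (d : R[i]), [/\ 0 < d, orthonormal_seq x,
    orthogonal_seq (fun n => A (x n)) & forall n, d <= `|A (x n)|].
Proof.
move=> sV /noncompact_bounded_below[d d0 dP].
have [adj adjP] := boolp.choice (fun w => adjoint_exists A w sV).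
have [F FP] := boolp.choice dP.
have [x xE] := sequence_by_history (fun _ s => F (s ++ [seq adj (A v) | v <- s])).
have ort n i : (i < n)%N -> inner (x n) (x i) = 0 /\ inner (A (x n)) (A (x i)) = 0.
  move=> i_n; rewrite adjP (xE n).
  have [h _ _] := FP (mkseq x n ++ [seq adj (A v) | v <- mkseq x n]).
  have xi : x i \in mkseq x n by rewrite map_f// mem_iota.
  by split; apply: h; rewrite mem_cat ?xi// map_f ?orbT.
exists x, d; split=> //; last first.
- by move=> n; rewrite xE; have [] := FP (mkseq x n ++ [seq adj (A v) | v <- mkseq x n]).
- by apply: orthogonal_seq_lt => n k kn; have [] := ort n k kn.
split; first by apply: orthogonal_seq_lt => n k kn; have [] := ort n k kn.
by move=> n; rewrite xE; have [] := FP (mkseq x n ++ [seq adj (A v) | v <- mkseq x n]).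
Qed.

End NonCompact.

(** * The open mapping theorem *)

Section OpenMapping.
Variable R : realType.

(** The harmonic sum stands for the minimum, which is awkward for a partial
    order. *)
Lemma common_lower_bound (a b : R[i]) : 0 < a -> 0 < b ->
  exists c, [/\ 0 < c, c <= a & c <= b].
Proof.
move=> a0 b0; exists (a^-1 + b^-1)^-1.
have s0 : 0 < a^-1 + b^-1 by rewrite addr_gt0 ?invr_gt0.
split; first by rewrite invr_gt0.
  by rewrite -[leRHS]invrK lef_pV2 ?posrE ?invr_gt0// lerDl invr_ge0 ltW.
by rewrite -[leRHS]invrK lef_pV2 ?posrE ?invr_gt0// lerDr invr_ge0 ltW.
Qed.

(** Baire category: if no S n were dense in some ball, one could choose nested
    balls, each one away from S n and of at most half the previous radius; their
    common point would be in no S n. *)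
Lemma baire_cover (W : completeNormedModType R[i]) (S : nat -> set W) :
    (forall y, exists n, S n y) ->
  exists (n : nat) (y : W) (r : R[i]), 0 < r /\ forall z, `|z - y| < r ->
    forall e, 0 < e -> exists2 s, S n s & `|z - s| < e.
Proof.
move=> Scov; apply: contrapT => no.
have step (p : nat * (W * R[i])) : exists q : W * R[i], 0 < p.2.2 ->
    [/\ 0 < q.2, q.2 <= p.2.2 / 2, q.2 + `|q.1 - p.2.1| <= p.2.2 &
        forall z, `|z - q.1| <= q.2 -> ~ S p.1 z].
  case: p => n [y r] /=; have [r0|rN] := pselect (0 < r); last by exists (y, r) => /rN.
  have [z [zy [e [e0 ze]]]] : exists z, `|z - y| < r /\ exists e, 0 < e /\
      forall s, S n s -> ~ (`|z - s| < e).
    apply: contrapT => noz; apply: no; exists n, y, r; split=> // z zy e e0.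
    apply: contrapT => nos; apply: noz; exists z; split=> //; exists e; split=> // s Sns zs.
    by apply: nos; exists s.
  have [c [c0 ce cr]] :=
    common_lower_bound (divr_gt0 e0 (ltr0Sn _ 1)) (divr_gt0 r0 (ltr0Sn _ 1)).
  have [c' [c'0 c'c c'z]] : exists c', [/\ 0 < c', c' <= c & c' <= r - `|z - y|].
    by apply: common_lower_bound => //; rewrite subr_gt0.
  exists (z, c') => _ /=; split=> //.
  - exact: le_trans cr.
  - by rewrite -lerBrDr.
  - move=> s sz Sns; apply: (ze s Sns); rewrite distrC.
    apply: (le_lt_trans sz); apply: (le_lt_trans c'c); apply: (le_lt_trans ce).
    by rewrite ltr_pdivrMr// mulr_natr mulr2n ltrDl.
have [F FP] := boolp.choice step.
pose g := fix g n := if n is m.+1 then F (m, g m) else ((0 : W), (1 : R[i])).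
have g0 n : 0 < (g n).2.
  by elim: n => [|n IHn] /=; [exact: ltr01|have [] := FP (n, g n) IHn].
have gP n := FP (n, g n) (g0 n).
have g_half n : (g n).2 <= 2^-1 ^+ n.
  elim: n => [|n IHn]; first by rewrite expr0.
  rewrite exprSr; have [_ h _ _] := gP n; apply: (le_trans h) => /=.
  by rewrite ler_wpM2r// invr_ge0.
have nest m n : (n <= m)%N -> (g m).2 + `|(g m).1 - (g n).1| <= (g n).2.
  move=> nm; rewrite -(subnKC nm); elim: (m - n)%N => [|k IHk].
    by rewrite addn0 subrr normr0 addr0.
  rewrite addnS; have [_ _ h _] := gP (n + k)%N; apply: le_trans IHk.
  apply: (le_trans _ (lerD h (lexx _))) => /=.
  by rewrite -addrA lerD2l (le_trans _ (ler_normD _ _))// addrA subrK.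
have dist m n : (n <= m)%N -> `|(g m).1 - (g n).1| <= (g n).2.
  by move/nest; apply: le_trans; rewrite lerDr ltW.
have [|l gl] := @cauchy_seq_cvg R W (fun n => (g n).1).
  move=> e e0; have [N Ne] := expV2_small (divr_gt0 e0 (ltr0Sn _ 1)).
  exists N => m n Nm mn; rewrite (le_lt_trans (dist _ _ mn))//.
  have gmN : (g m).2 <= (g N).2.
    by apply: le_trans (nest _ _ Nm); rewrite lerDl.
  rewrite (le_lt_trans gmN)// (le_lt_trans (g_half N))// (lt_trans Ne)//.
  by rewrite ltr_pdivrMr// mulr_natr mulr2n ltrDl.
have lg n : `|l - (g n).1| <= (g n).2.
  apply: ler_of_gt0 => [||e e0]; rewrite ?normr_real ?gtr0_real//.
  have [N] := (iffLR (seq_cvgP _ _) gl) e e0.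
  move=> /(_ _ (leq_maxl N n)) h.
  rewrite -(subrK (g (maxn N n)).1 l) -addrA (le_trans (ler_normD _ _))// [leRHS]addrC lerD//.
    exact: ltW.
  by apply: dist; exact: leq_maxr.
have [n Snl] := Scov l.
by have [_ _ _ /(_ l)] := gP n; apply => //; exact: (lg n.+1).
Qed.

(** By [baire_cover], the image of a ball is dense in a ball around 0 after taking
    differences, so any w is approximated by some T x with |x| <= K |w|.  Applying
    this to the successive errors, which are halved each time, gives a series that
    converges to an exact preimage. *)
Theorem open_mapping (V W : completeNormedModType R[i]) (T : 'B(V, W)) :
    (forall y, exists x, T x = y) ->
  exists2 M : R[i], 0 < M & forall y, exists2 x, T x = y & `|x| <= M * `|y|.
Proof.
move=> Tsurj.
have [|n [y0 [r [r0 nP]]]] :=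
    @baire_cover W (fun n => [set T x | x in [set x | `|x| <= n%:R :> R[i]]]).
  move=> y; have [x xy] := Tsurj y; have [n xn] := complex_archi `|x|.
  by exists n; exists x => //=; rewrite normr_id in xn; exact: ltW.
have approx w (e : R[i]) : 0 < e -> `|w| < r ->
    exists2 x, `|x| <= n%:R + n%:R & `|w - T x| < e.
  move=> e0 wr; have e2 : 0 < e / 2 by rewrite divr_gt0.
  have [|_ [x1 x1n <-] h1] := nP (y0 + w) _ _ e2; first by rewrite addrC addKr.
  have [|_ [x2 x2n <-] h2] := nP y0 _ _ e2; first by rewrite subrr normr0.
  exists (x1 - x2); first by rewrite (le_trans (ler_normB _ _))// lerD.
  have -> : w - T (x1 - x2) = (y0 + w - T x1) - (y0 - T x2).
    by rewrite linearB !opprB [RHS]addrC !addrA subrK (addrC w).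
  by rewrite (le_lt_trans (ler_normB _ _))// (splitr e) ltrD.
pose K : R[i] := (n%:R + n%:R) * 2 / r + 1.
have K0 : 0 < K by rewrite ltr_wpDl// divr_ge0 ?mulr_ge0 ?addr_ge0 ?ler0n// ltW.
have approxK (p : W * R[i]) : exists x, 0 < p.2 ->
    `|x| <= K * `|p.1| /\ `|p.1 - T x| < p.2.
  case: p => w e /=; have [e0|eN] := pselect (0 < e); last by exists 0 => /eN.
  have [->|w0] := eqVneq w 0; first by exists 0 => _; rewrite linear0 subrr !normr0 mulr0.
  have nw : 0 < `|w| by rewrite normr_gt0.
  (* t w has norm r / 2, inside the ball where approximation is possible *)
  pose t := r / (`|w| * 2).
  have t0 : 0 < t by rewrite divr_gt0// mulr_gt0.
  have [||x xn xe] := approx (t *: w) (t * e); first by rewrite mulr_gt0.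
    rewrite normrZ (gtr0_norm t0) /t.
    have -> : r / (`|w| * 2) * `|w| = r / 2 by field; rewrite gt_eqF.
    by rewrite ltr_pdivrMr// mulr_natr mulr2n ltrDl.
  exists (t^-1 *: x) => _; split.
    rewrite normrZ normfV (gtr0_norm t0) mulrC ler_pdivrMr//.
    apply: (le_trans xn); rewrite /t /K.
    have -> : ((n%:R + n%:R) * 2 / r + 1) * `|w| * (r / (`|w| * 2)) =
      n%:R + n%:R + r / 2 by field; rewrite !gt_eqF.
    by rewrite lerDl divr_ge0// ltW.
  have -> : w - T (t^-1 *: x) = t^-1 *: (t *: w - T x).
    by rewrite linearZ scalerBr scalerA mulVf ?scale1r// gt_eqF.
  by rewrite normrZ normfV (gtr0_norm t0) mulrC ltr_pdivrMr// mulrC.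
have [G GP] := boolp.choice approxK.
exists (K * 2); first by rewrite mulr_gt0.
move=> y; have [->|yN0] := eqVneq y 0; first by exists 0; rewrite ?linear0// !normr0 mulr0.
have ny : 0 < `|y| by rewrite normr_gt0.
pose h k : R[i] := 2^-1 ^+ k * `|y|.
have h0 k : 0 < h k by rewrite mulr_gt0// exprn_gt0// invr_gt0.
have hS k : h k.+1 + h k.+1 = h k.
  by rewrite /h exprS; field.
pose w := fix w k := if k is m.+1 then w m - T (G (w m, h m.+1)) else y.
pose x k := G (w k, h k.+1).
have wh k : `|w k| <= h k.
  case: k => [|k]; first by rewrite /h expr0 mul1r.
  by have [_ /ltW] := GP (w k, h k.+1) (h0 _).
have xh k : `|x k| <= K * h k.
  have [xw _] := GP (w k, h k.+1) (h0 _).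
  by apply: (le_trans xw); rewrite ler_pM2l //=; exact: wh.
have tail m n' : (m <= n')%N -> `|\sum_(m <= k < n') x k| <= K * 2 * h m.
  move=> mn; suff : `|\sum_(m <= k < n') x k| <= K * 2 * (h m - h n').
    move/le_trans; apply; rewrite ler_pM2l ?mulr_gt0//.
    by rewrite gerBl ltW.
  rewrite -(subnKC mn); elim: (n' - m)%N => [|k IHk].
    by rewrite addn0 big_geq// normr0 subrr mulr0.
  rewrite addnS big_nat_recr ?leq_addr//= (le_trans (ler_normD _ _))//.
  apply: (le_trans (lerD IHk (xh _))).
  rewrite -subr_ge0 -(hS (m + k)%N).
  set a := h m; set b := h (m + k).+1.
  have -> : K * 2 * (a - b) - (K * 2 * (a - (b + b)) + K * (b + b)) = 0 by ring.
  exact: lexx.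
have [|l xl] := @cauchy_seq_cvg R V (fun n' => \sum_(0 <= k < n') x k).
  move=> e e0.
  have [N Ne] : exists N, K * 2 * h N < e.
    have [|N hN] := @expV2_small R (e / (K * 2 * `|y|)); first by rewrite divr_gt0// !mulr_gt0.
    by exists N; move: hN; rewrite ltr_pdivlMr ?mulr_gt0// /h mulrCA.
  exists N => m n' Nm mn; rewrite (big_cat_nat (leq0n m) mn)/= addrAC subrr add0r.
  apply: le_lt_trans Ne; apply: le_trans (tail _ _ mn) _.
  rewrite ler_pM2l ?mulr_gt0// /h ler_pM2r// -(subnKC Nm) exprD.
  rewrite ler_piMr ?exprn_ge0 ?invr_ge0//.
  by rewrite exprn_ile1 ?invr_ge0// invf_le1// ler1n.
exists l; last first.
  apply: (cvg_seq_norm_le xl) => n'; apply: (le_trans (tail 0%N n' (leq0n _))).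
  by rewrite /h expr0 mul1r.
apply: (cvg_seq_unique (bounded_map_cvg (T := T) xl)); apply/seq_cvgP => e e0.
have [N Ne] : exists N, h N < e.
  have [|N hN] := @expV2_small R (e / `|y|); first by rewrite divr_gt0.
  by exists N; rewrite /h -ltr_pdivlMr.
exists N => n' Nn.
have -> : y - T (\sum_(0 <= k < n') x k) = w n'.
  elim: n' {Nn} => [|k IHk]; first by rewrite big_geq// linear0 subr0.
  by rewrite big_nat_recr//= linearD opprD addrA IHk.
apply: (le_lt_trans (wh _)); apply: le_lt_trans Ne.
rewrite /h ler_pM2r// -(subnKC Nn) exprD ler_piMr ?exprn_ge0 ?invr_ge0//.
by rewrite exprn_ile1 ?invr_ge0// invf_le1// ler1n.
Qed.

End OpenMapping.

(** * Dimension of quotients *)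

Section Dimension.
Variable C : numClosedFieldType.
Implicit Types V : lmodType C.

Lemma quotient_dim_finP V (U W : set V) :
  (quotient_dim U W < +oo)%E <-> exists n (e : 'I_n -> V), quotient_basis U W e.
Proof.
rewrite /quotient_dim; case: xgetP => [_ -> [n [e eP] <-]|no].
  by split=> // _; exists n, e.
split; first by rewrite ltxx.
by move=> [n [e eP]]; exfalso; apply: (no (n%:Z)%:E%E); exists n => //; exists e.
Qed.

Lemma quotient_dim_inftyP V (U W : set V) :
  quotient_dim U W = +oo%E <-> ~ exists n (e : 'I_n -> V), quotient_basis U W e.
Proof.
rewrite -quotient_dim_finP; split=> [->|]; first by rewrite ltxx.
by move/negP; rewrite -leNgt leye_eq => /eqP.
Qed.

Lemma eq_quotient_dim V (U W : set V) V' (U' W' : set V') :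
  (forall n, (exists e : 'I_n -> V, quotient_basis U W e) <->
     exists e : 'I_n -> V', quotient_basis U' W' e) ->
  quotient_dim U W = quotient_dim U' W'.
Proof.
move=> UW; rewrite /quotient_dim; congr (xget _ [set _ | _ in _]).
by apply/funext => n; apply/propext; exact: UW.
Qed.

(** A finite spanning family contains a basis: as long as there is a nontrivial
    relation, a vector with nonzero coefficient in it can be removed. *)
Lemma quotient_basis_of_span V (U W : set V) n (e : 'I_n -> V) : linear_subspace W ->
    (forall i, U (e i)) ->
    (forall x, U x -> exists c : 'rV[C]_n, W (x - \sum_i c 0 i *: e i)) ->
  exists m (f : 'I_m -> V), quotient_basis U W f.
Proof.
move=> Wl; elim: n e => [|n IHn] e Ue espan.
  exists 0%N, e; split=> // x /espan[c Wc]; exists c; split=> // c' _.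
  by apply/rowP => -[].
have [indep|] := pselect (forall c : 'rV[C]_n.+1, W (\sum_i c 0 i *: e i) -> c = 0).
  exists n.+1, e; split=> // x /espan[c Wc]; exists c; split=> // c' Wc'.
  apply/eqP; rewrite -subr_eq0; apply/eqP; apply: indep.
  have -> : \sum_i (c - c') 0 i *: e i =
      (x - \sum_i c' 0 i *: e i) - (x - \sum_i c 0 i *: e i).
    rewrite opprB [RHS]addrC addrA subrK -sumrB.
    by apply: eq_bigr => i _; rewrite !mxE scalerBl.
  exact: linear_subspaceB.
move=> /existsNP[c /not_implyP[Wc /eqP c0]].
have [j cj] : exists j, c 0 j != 0.
  apply: contrapT => no; move/eqP: c0; apply; apply/rowP => j; rewrite mxE.
  by apply/eqP/negP => /negP cj; apply: no; exists j.
apply: (IHn (fun i => e (lift j i))) => [i|x Ux]; first exact: Ue.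
have [d Wd] := espan x Ux.
exists (\row_i (d 0 (lift j i) - d 0 j / c 0 j * c 0 (lift j i))).
set y := (Y in W Y).
suff -> : y = (d 0 j / c 0 j) *: (\sum_i c 0 i *: e i) + (x - \sum_i d 0 i *: e i).
  exact: Wl.2.
rewrite /y (bigD1_ord j)//= [\sum_(i < n.+1) d 0 i *: _](bigD1_ord j)//=.
rewrite scalerDr scalerA divfK// scaler_sumr.
under eq_bigr do rewrite mxE scalerBl -scalerA.
have zmod (a p b s : V) : a - (b - s) = (p + s) + (a - (p + b)).
  by rewrite opprB opprD [a + (- p - b)]addrCA [RHS]addrACA subrr add0r [RHS]addrCA.
by rewrite sumrB; exact: zmod.
Qed.

Lemma tall_matrix_kernel n (G : 'M[C]_(n.+1, n)) :
  exists2 u : 'rV[C]_n.+1, u != 0 & u *m G = 0.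
Proof.
have /rowV0Pn[u uG u0] : kermx G != 0.
  by rewrite -mxrank_eq0 mxrank_ker subn_eq0 -ltnNge ltnS rank_leq_col.
by exists u => //; apply/sub_kermxP.
Qed.

Lemma vdim_infinite V (U : set V) (x : nat -> V) : (forall n, U (x n)) ->
    (forall n (c : 'rV[C]_n), \sum_i c 0 i *: x i = 0 -> c = 0) ->
  vdim U = +oo%E.
Proof.
move=> Ux indep; apply/quotient_dim_inftyP => -[n [e [Ue espan]]].
have /boolp.choice[a aP] : forall k : 'I_n.+1, exists c : 'rV[C]_n,
    x k = \sum_i c 0 i *: e i.
  move=> k; have [c [/= /eqP h _]] := espan _ (Ux k).
  by exists c; apply/eqP; rewrite -subr_eq0.
pose A : 'M[C]_(n.+1, n) := \matrix_(k, i) a k 0 i.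
have [u u0 uA] := tall_matrix_kernel A.
move/eqP: u0; apply; apply: indep.
under eq_bigr => k _ do rewrite aP scaler_sumr.
rewrite exchange_big big1// => i _.
under eq_bigr => k _ do rewrite scalerA.
rewrite -scaler_suml; have /rowP/(_ i) := uA; rewrite !mxE => h.
rewrite (_ : \sum_k _ = 0) ?scale0r// -[RHS]h.
by apply: eq_bigr => k _; rewrite mxE.
Qed.

Lemma surjective_finite_defect (V W : normedModType C) (T : 'B(V, W)) :
  range T = setT -> (defect T < +oo)%E.
Proof.
move=> rT; apply/quotient_dim_finP; exists 0%N, (fun=> 0); split=> // y _.
exists 0; split; last by move=> c _; apply/rowP => -[].
by rewrite big_ord0 rT.
Qed.

(** The defect is a purely algebraic quantity, preserved by any linear bijection of
    the target, continuous or not. *)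
Lemma defect_transport (V W : normedModType C) (T T' : 'B(V, W)) (w w' : W -> W) :
    linear w -> linear w' -> cancel w w' -> cancel w' w ->
    (forall x, T' x = w (T x)) -> defect T' = defect T.
Proof.
have one (S S' : 'B(V, W)) (f f' : {linear W -> W}) n (e : 'I_n -> W) :
    cancel f f' -> cancel f' f -> (forall x, S' x = f (S x)) ->
    quotient_basis setT (range S) e -> quotient_basis setT (range S') (f \o e).
  move=> fK f'K SS' [_ espan]; split=> // y _.
  have eqv (c : 'rV[C]_n) : range S' (y - \sum_i c 0 i *: f (e i)) <->
      range S (f' y - \sum_i c 0 i *: e i).
    have fE : f (f' y - \sum_i c 0 i *: e i) = y - \sum_i c 0 i *: f (e i).
      rewrite linearB f'K linear_sum; congr (_ - _).
      by apply: eq_bigr => i _; rewrite linearZ.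
    split=> -[x _ xE]; exists x => //; last by rewrite SS' xE fE.
    by apply: (can_inj fK); rewrite -SS' xE fE.
  have [c [Sc c_uniq]] := espan (f' y) I.
  exists c; split; first by apply/eqv.
  by move=> c' /eqv; exact: c_uniq.
move=> wl w'l wK w'K TT'.
pose f : {linear W -> W} := HB.pack w (GRing.isLinear.Build _ _ _ _ w wl).
pose f' : {linear W -> W} := HB.pack w' (GRing.isLinear.Build _ _ _ _ w' w'l).
apply: eq_quotient_dim => n; split=> -[e eP].
  exists (f' \o e); apply: (one T' T f' f) eP => // x.
  by rewrite TT' /= wK.
by exists (f \o e); apply: (one T T' f f') eP.
Qed.

End Dimension.

(** * Fredholm operators and compact corners *)

Section FredholmCompact.
Variable R : realType.
Implicit Types V W : hilbertType R[i].

(** The orthogonal projection onto the span of a finite family, obtained from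
    Gram-Schmidt on the family followed by zeros. *)
Lemma finite_projection V n (e : 'I_n -> V) : exists P : 'B(V, V),
  [/\ forall i, P (e i) = e i,
      forall x, exists c : 'rV[R[i]]_n, P x = \sum_i c 0 i *: e i,
      forall x i, inner (x - P x) (e i) = 0,
      forall x, `|P x| <= `|x| /\ `|x - P x| <= `|x| &
      forall (I : Type) (S : set I) (g : I -> V) (M : R[i]),
        (forall x, S x -> `|g x| <= M) -> totally_bounded_on S (fun x => P (g x))].
Proof.
have [b [bS b0 be bN]] := gram_schmidt (nth 0 (codom e)).
have [P PD] := semi_orthonormal_operator bS bS.
have se : size (codom e) = n by rewrite size_codom card_ord.
have nth_e (i : 'I_n) : nth 0 (codom e) i = e i.
  by rewrite codomE (nth_map i) ?size_enum_ord// nth_ord_enum.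
have PE x : P x = \sum_(0 <= k < n) inner x (b k) *: b k.
  by apply: (diagonal_finite PD) => m nm; rewrite b0// nth_default// se.
pose N : set V := [set x | exists c : 'rV[R[i]]_n, x = \sum_i c 0 i *: e i].
have Nl : linear_subspace N.
  split=> [|a x y [c ->] [d ->]].
    by exists 0; rewrite big1// => i _; rewrite mxE scale0r.
  exists (a *: c + d); rewrite scaler_sumr -big_split/=.
  by apply: eq_bigr => i _; rewrite !mxE scalerDl scalerA.
have Ne i : N (e i).
  exists (delta_mx 0 i); rewrite (bigD1 i)//= mxE !eqxx scale1r big1 ?addr0// => j ji.
  by rewrite mxE (negPf ji) andbF scale0r.
have Nb : forall k, N (b k).
  apply: bN => // k; have [kn|nk] := ltnP k n; last by rewrite nth_default ?se//; exact: Nl.1.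
  by rewrite (nth_e (Ordinal kn)).
have NP x : N (P x) by rewrite PE; exact: subspace_sum.
have orth x i : inner (x - P x) (e i) = 0.
  by rewrite -nth_e; apply: be => k; exact: projection_orth.
have orthN x y : N y -> inner (x - P x) y = 0.
  by move=> [c ->]; rewrite inner_sumr big1// => i _; rewrite innerZr orth mulr0.
exists P; split=> //.
- move=> i; apply/esym/eqP; rewrite -subr_eq0 -normr_eq0 -sqrf_eq0 -inner_norm.
  by rewrite orthN//; exact: linear_subspaceB.
- by move=> x; split; [exact: (projection_le bS PD)|exact: (projection_rest_le bS PD)].
- move=> I S g M gM; rewrite (_ : (fun x => P (g x)) =
    (fun x => \sum_(0 <= k < n) inner (g x) (b k) *: b k)); last first.
    by apply/funext => x; rewrite PE.
  apply: (@totally_bounded_sum _ _ _ _ _ _ M) => k x Sx.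
  apply: le_trans (cauchy_schwarz _ _) _; apply: le_trans (gM x Sx).
  by rewrite ler_piMr// semi_orthonormal_le1.
Qed.

Lemma infinite_dim_orth V : vdim [set: V] = +oo%E ->
  forall s : seq V, exists2 x : V, setT x & x != 0 /\ forall v, v \in s -> inner x v = 0.
Proof.
move/quotient_dim_inftyP => infV s; apply: contrapT => no; apply: infV.
have [P [_ Pspan Porth _ _]] := finite_projection (fun i : 'I_(size s) => nth 0 s i).
apply: (quotient_basis_of_span (e := fun i : 'I_(size s) => nth 0 s i)) => //.
  by split=> // a x y -> ->; rewrite scaler0 addr0.
move=> x _; have [c xc] := Pspan x; exists c; rewrite /= -xc.
apply/eqP/negP => /negP x0; apply: no; exists (x - P x) => //; split=> // v vs.
rewrite -(nth_index 0 vs); move: vs; rewrite -index_mem => vs.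
exact: (Porth x (Ordinal vs)).
Qed.

(** The open mapping theorem for operators of finite defect, obtained from the
    surjective operator (x, z) |-> T x + P z; taking z in all of W instead of in the
    finite-dimensional range of P keeps the domain a Hilbert space. *)
Lemma finite_defect_open V W (T : 'B(V, W)) n (e : 'I_n -> W) (P : 'B(W, W)) :
    quotient_basis setT (range T) e -> (forall i, P (e i) = e i) ->
    (forall x, `|P x| <= `|x|) ->
  exists2 M : R[i], 0 < M & forall y, exists x z,
    [/\ y = T x + P z, `|x| <= M * `|y| & `|z| <= M * `|y|].
Proof.
move=> [_ espan] Pe P1; have [MT MT0 TM] := bounded_map_pos T.
pose f (p : hsum V W) : W := T p.1 + P p.2.
have [||L Lf] := @bounded_linear_pack R (hsum V W) W f (MT + 1).
- by move=> a x y; rewrite /f /= !linearP scalerDr addrACA.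
- move=> p; rewrite (le_trans (ler_normD _ _))// mulrDl mul1r lerD//.
    by rewrite (le_trans (TM _))// ler_pM2l// hsum_norm_fst.
  by rewrite (le_trans (P1 _))// hsum_norm_snd.
have [|M M0 MP] := open_mapping (T := L).
  move=> y; have [c [[x _ xc] _]] := espan y I.
  exists ((x, \sum_i c 0 i *: e i) : hsum V W); rewrite Lf /f /= xc.
  suff -> : P (\sum_i c 0 i *: e i) = \sum_i c 0 i *: e i by rewrite subrK.
  by rewrite linear_sum; apply: eq_bigr => i _; rewrite linearZ/= Pe.
exists M => // y; have [p py pM] := MP y; exists p.1, p.2; split.
- by rewrite -py Lf.
- by rewrite (le_trans (hsum_norm_fst p)).
- by rewrite (le_trans (hsum_norm_snd p)).
Qed.

(** A Fredholm operator is bounded below modulo its kernel, and the kernel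
    components of a bounded family are totally bounded since the kernel is
    finite-dimensional. *)
Lemma fredholm_totally_bounded V W (T : 'B(V, W)) (J : Type) (S : set J) (f : J -> V)
    (M : R[i]) : (nullity T < +oo)%E -> (defect T < +oo)%E ->
    (forall x, S x -> `|f x| <= M) -> totally_bounded_on S (fun x => T (f x)) ->
  totally_bounded_on S f.
Proof.
move=> /quotient_dim_finP[m [b [bN bspan]]] /quotient_dim_finP[n [e eP]] fM TfS.
have [Q [Qe Qspan _ Q1 _]] := finite_projection e.
have [L L0 LP] := finite_defect_open eP Qe (fun x => (Q1 x).1).
have [P [Pb _ _ P1 Ptb]] := finite_projection b.
have Pker x : T x = 0 -> P x = x.
  move=> Tx; have [c [/= /eqP]] := bspan x Tx; rewrite subr_eq0 => /eqP -> _.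
  by rewrite linear_sum; apply: eq_bigr => i _; rewrite linearZ/= Pb.
apply: (@totally_bounded_lift _ _ _ _ _ _ _ _ _ (L + 1) _ TfS (Ptb _ _ _ _ fM)).
  by rewrite addr_gt0.
move=> x y Sx Sy.
have [u [z [Tu uL _]]] := LP (T (f x) - T (f y)).
(* the component z along the complement of the range vanishes, by uniqueness *)
have Tu0 : T (f x) - T (f y) = T u.
  have [c zc] := Qspan z; have [_ espan] := eP.
  have [c' [_ c'_uniq]] := espan (T (f x) - T (f y) - T u) I.
  have c'c : c' = c.
    apply: c'_uniq; exists 0 => //.
    by rewrite linear0 Tu zc [T u + _]addrC addrK subrr.
  have c'0 : c' = 0.
    apply: c'_uniq; exists (f x - f y - u); rewrite // big1 ?subr0 ?linearB//.
    by move=> i _; rewrite mxE scale0r.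
  by rewrite Tu zc -c'c c'0 big1 ?addr0// => i _; rewrite mxE scale0r.
have Pd : P (f x) - P (f y) - P u = f x - f y - u.
  by rewrite -!linearB/= Pker// linearB/= linearB/= Tu0 subrr.
have -> : f x - f y = (u - P u) + (P (f x) - P (f y)).
  by rewrite -[LHS](subrK u) -Pd addrAC [RHS]addrC addrA addrAC.
rewrite (le_trans (ler_normD _ _))// mulrDl mul1r lerD//.
  rewrite (le_trans (P1 u).2)// (le_trans uL)// ler_pM2l// lerDl//.
by rewrite lerDr.
Qed.

Lemma compact_map_bounded_sets V W (A : 'B(V, W)) (I : Type) (S : set I) (f : I -> V)
    (M : R[i]) : compact_operator A -> 0 < M -> (forall x, S x -> `|f x| <= M) ->
  totally_bounded_on S (fun x => A (f x)).
Proof.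
move=> /precompact_totally_bounded Atb M0 fM.
have tb : totally_bounded_on S (fun x => A (M^-1 *: f x)).
  apply: (totally_bounded_reindex (f := fun x => M^-1 *: f x) _ Atb) => x Sx /=.
  by rewrite normrZ normfV (gtr0_norm M0) mulrC ler_pdivrMr// mul1r fM.
apply: (totally_bounded_lift M0 tb tb) => x y _ _.
have -> : A (M^-1 *: f x) - A (M^-1 *: f y) = M^-1 *: (A (f x) - A (f y)).
  by rewrite scalerBr; congr (_ - _); exact: linearZ.
rewrite normrZ normfV (gtr0_norm M0).
by rewrite mulrDr !mulrA mulfV ?gt_eqF// !mul1r lerDl.
Qed.

(** Two terms of an orthonormal sequence have distance sqrt 2, so they cannot share
    a colour of mesh 1. *)
Lemma unit_ball_not_totally_bounded V : separable V -> vdim [set: V] = +oo%E ->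
  ~ totally_bounded_on [set x : V | `|x| <= 1] id.
Proof.
move=> sV iV tb.
have Tl : linear_subspace [set: V] by [].
have [b [bo b1] _] := exists_orthonormal_basis sV Tl (infinite_dim_orth iV).
have [F [c cP]] := tb 1 ltr01.
pose g (k : 'I_#|F|.+1) := c (b k).
have : ~~ injectiveb g.
  by apply/injectiveP => /leq_card; rewrite card_ord ltnn.
move/injectivePn => [i [j ij gij]].
have bS k : [set x : V | `|x| <= 1] (b k) by rewrite /= b1.
have := cP _ _ (bS i) (bS j) gij.
have bij : `|b i - b j| ^+ 2 = 1 + 1.
  rewrite -scaleN1r norm2D_orth; first by rewrite normrZ normrN1 mul1r !b1 expr1n.
  by rewrite innerZr bo ?mulr0.
rewrite -(@ltr_pXn2r _ 2) ?nnegrE// bij expr1n gtrDl.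
by rewrite ltr10.
Qed.

(** Solve (0, k) = M_D (x, y) + f with bounded data for all k in the unit ball:
    total boundedness passes from A x and f to D y, then to y, then to k. *)
Theorem compact_corner_not_finite_defect (H K : hilbertType R[i])
    (A : 'B(H, H)) (B : 'B(K, K)) (D : 'B(K, H)) :
    separable K -> vdim [set: K] = +oo%E -> compact_operator A -> Fredholm D ->
  ~ (defect (upper_triangular A B D) < +oo)%E.
Proof.
move=> sK iK Ac [_ Dn Dd] /quotient_dim_finP[n [e eP]].
apply: (unit_ball_not_totally_bounded sK iK).
have [P [Pe _ _ P1 Ptb]] := finite_projection e.
have [M M0 MP] := finite_defect_open eP Pe (fun x => (P1 x).1).
have [x xP] := boolp.choice (fun k : K => MP ((0, k) : hsum H K)).
have [z zP] := boolp.choice xP.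
set S := [set k : K | `|k| <= 1].
have kM k : S k -> M * `|(0, k) : hsum H K| <= M.
  move=> Sk; rewrite -[leRHS]mulr1 ler_pM2l//.
  by rewrite (le_trans (hsum_norm_le _))//= normr0 add0r.
have xM k : S k -> `|x k| <= M by move=> /kM; apply: le_trans; have [] := zP k.
have zM k : S k -> `|z k| <= M by move=> /kM; apply: le_trans; have [] := zP k.
have zE k : A (x k).1 + D (x k).2 + (P (z k)).1 = 0 /\ B (x k).2 + (P (z k)).2 = k.
  have [h _ _] := zP k.
  by split; [move/(congr1 fst): h|move/(congr1 snd): h] => /= <-.
have Atb : totally_bounded_on S (fun k => A (x k).1).
  apply: (compact_map_bounded_sets Ac M0) => k /xM; apply: le_trans.
  exact: hsum_norm_fst.
have Pztb := Ptb _ _ _ _ zM.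
have Dtb : totally_bounded_on S (fun k => D (x k).2).
  have DE k : D (x k).2 = - (A (x k).1 + (P (z k)).1).
    by apply/eqP; rewrite -addr_eq0 addrA [D _ + _]addrC (zE k).1.
  apply: (totally_bounded_lift ltr01 Atb Pztb) => k l _ _; rewrite mul1r !DE.
  rewrite -opprD normrN opprD addrACA (le_trans (ler_normD _ _))// lerD2l.
  exact: (hsum_norm_fst (P (z k) - P (z l))).
have ytb : totally_bounded_on S (fun k => (x k).2).
  apply: (fredholm_totally_bounded Dn Dd _ Dtb (M := M)) => k /xM; apply: le_trans.
  exact: hsum_norm_snd.
have [b b0 Bb] := bounded_map_pos B.
apply: (totally_bounded_lift (M := b + 1) _ ytb Pztb) => [|k l _ _].
  by rewrite addr_gt0.
rewrite /= -[in leLHS](zE k).2 -[in leLHS](zE l).2 opprD addrACA.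
rewrite (le_trans (ler_normD _ _))// mulrDr lerD//.
  by rewrite -linearB (le_trans (Bb _))// ler_wpM2r// lerDl.
rewrite (le_trans (hsum_norm_snd (P (z k) - P (z l))))//.
by rewrite ler_peMl// lerDr ltW.
Qed.

End FredholmCompact.

(** * Unitary operators between orthogonal decompositions *)

Section Completion.
Variable R : realType.
Implicit Types V W : hilbertType R[i].

Lemma orthonormal_independent V (b : nat -> V) : orthonormal_seq b ->
  forall n (c : 'rV[R[i]]_n), \sum_i c 0 i *: b i = 0 -> c = 0.
Proof.
move=> [bo b1] n c c0; apply/rowP => j; rewrite mxE.
have := congr1 (fun x => inner x (b j)) c0; rewrite inner0l inner_suml (bigD1 j)//=.
rewrite innerZl inner_norm b1 expr1n mulr1 big1 ?addr0// => i ij.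
by rewrite innerZl bo ?mulr0.
Qed.

(** A nontrivial combination of the first n + 1 terms of b can be made orthogonal
    to n given vectors. *)
Lemma orthonormal_avoid V (N : set V) (b : nat -> V) : linear_subspace N ->
    orthonormal_seq b -> (forall n, N (b n)) ->
  forall s : seq V, exists2 x, N x & x != 0 /\ forall v, v \in s -> inner x v = 0.
Proof.
move=> Nl bO Nb s; pose n := size s.
pose G : 'M[R[i]]_(n.+1, n) := \matrix_(k, i) inner (b k) (nth 0 s i).
have [u u0 uG] := tall_matrix_kernel G.
exists (\sum_i u 0 i *: b i); first exact: subspace_sum.
split.
  by apply: contra u0 => /eqP u0; apply/eqP; exact: orthonormal_independent u0.
move=> v vs; have vn : (index v s < n)%N by rewrite index_mem.
have /rowP/(_ (Ordinal vn)) := uG; rewrite !mxE => h.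
rewrite inner_suml -[RHS]h; apply: eq_bigr => k _.
by rewrite innerZl mxE /= nth_index.
Qed.

Lemma surjective_finite_kernel_fredholm V W (T : 'B(V, W)) n (e : 'I_n -> V) :
    range T = setT -> (forall i, T (e i) = 0) ->
    (forall x, T x = 0 -> exists c : 'rV[R[i]]_n, x = \sum_i c 0 i *: e i) ->
  Fredholm T.
Proof.
move=> Tsurj Te Tker.
have dT := surjective_finite_defect Tsurj.
split=> //; first by right.
apply/quotient_dim_finP; apply: (quotient_basis_of_span (e := e)) => //.
  by split=> // a x y -> ->; rewrite scaler0 addr0.
by move=> x /Tker[c xc]; exists c; rewrite /= xc subrr.
Qed.

(** Choose a preimage under B modulo a finite complement of the range; it is unique
    up to N(B), which E kills. *)
Lemma factor_through V W (B : 'B(V, V)) (E : 'B(V, W)) : (defect B < +oo)%E ->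
  (forall x, B x = 0 -> E x = 0) -> exists2 G : V -> W, linear G & forall x, G (B x) = E x.
Proof.
move=> /quotient_dim_finP[n [f [_ fspan]]] BE.
pose F (c : 'rV[R[i]]_n) := \sum_i c 0 i *: f i.
have FD a c d : F (a *: c + d) = a *: F c + F d.
  rewrite /F scaler_sumr -big_split/=; apply: eq_bigr => i _.
  by rewrite !mxE scalerDl scalerA.
have F0 : F 0 = 0 by rewrite /F big1// => i _; rewrite mxE scale0r.
have ex x : exists p : V * 'rV[R[i]]_n, x = B p.1 + F p.2.
  have [c [[s _ sE] _]] := fspan x I; exists (s, c).
  by rewrite /= sE subrK.
have [p pP] := boolp.choice ex.
have uniq s t c d : B s + F c = B t + F d -> E s = E t.
  move=> st; have [c' [_ c'u]] := fspan (B s + F c) I.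
  have cd : c = d.
    rewrite -(c'u c) ?(c'u d)//; first by exists t; rewrite // st -/(F d) addrK.
    by exists s; rewrite // -/(F c) addrK.
  apply/eqP; rewrite -subr_eq0 -linearB; apply/eqP; apply: BE; rewrite linearB/=.
  by move: st; rewrite cd => /addIr ->; rewrite subrr.
exists (fun x => E (p x).1) => [a x y|x]; last first.
  by apply: (uniq _ _ (p (B x)).2 0); rewrite -pP F0 addr0.
rewrite -linearP; apply: (uniq _ _ (p (a *: x + y)).2 (a *: (p x).2 + (p y).2)).
by rewrite -pP linearP FD addrACA -scalerDr -!pP.
Qed.

(** Only the even terms of z are kept, so that the odd ones make the orthogonal
    complement infinite-dimensional. *)
Lemma half_completion V (z : nat -> V) : separable V -> orthonormal_seq z ->
  exists2 q : nat -> V, orthonormal_seq q &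
    complete_in (orthocomplement (fun n => z n.*2)) q.
Proof.
move=> sV zO; have Nl := orthocomplement_linear (fun n => z n.*2).
apply: exists_orthonormal_basis => //.
apply: (@orthonormal_avoid _ _ (fun n => z n.*2.+1)) => //.
  by apply: (orthonormal_sub (s := fun n => n.*2.+1)) zO => i j [] /double_inj.
move=> n k; apply: zO.1; apply/eqP => /(congr1 odd); rewrite /= !odd_double//.
Qed.

Lemma orthonormal_even V (z : nat -> V) : orthonormal_seq z ->
  orthonormal_seq (fun n => z n.*2).
Proof. exact: (orthonormal_sub (s := double)) double_inj. Qed.

Section Unitary.
Variables (V W : hilbertType R[i]).

Lemma resolution_identity (p q : nat -> V) (P Q : 'B(V, V)) :
    orthonormal_seq p -> orthonormal_seq q -> complete_in (orthocomplement p) q ->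
    diagonal p p P -> diagonal q q Q -> forall x, P x + Q x = x.
Proof.
move=> pO qO [qN qC] PD QD x.
apply/eqP; rewrite -subr_eq0 -oppr_eq0 opprB; apply/eqP; apply: qC => n.
  rewrite opprD addrA innerBl (projection_orth (orthonormal_semi pO) PD) sub0r.
  by rewrite (diagonal_inner0 QD) ?oppr0// => k; exact: qN.
rewrite opprD addrCA addrC innerDl innerBl.
rewrite -innerBl (projection_orth (orthonormal_semi qO) QD) add0r.
rewrite -[- P x]sub0r innerBl inner0l.
rewrite (diagonal_inner0 PD) ?subrr// => k; apply: inner_eq0C; exact: qN.
Qed.

(** The operator D maps p to w and q to v.  If p and q together form an orthonormal
    basis, and w and v as well, it is unitary, and its inverse is glued from the
    reversed pairs ([glue_operator_inverse]). *)
Lemma glue_operator (p q : nat -> V) (w v : nat -> W) :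
    orthonormal_seq p -> orthonormal_seq q -> orthonormal_seq w -> orthonormal_seq v ->
  exists (S T D : 'B(V, W)), [/\ diagonal p w S, diagonal q v T & forall x, D x = S x + T x].
Proof.
move=> /orthonormal_semi pO /orthonormal_semi qO /orthonormal_semi wO /orthonormal_semi vO.
have [S SD] := semi_orthonormal_operator pO wO.
have [T TD] := semi_orthonormal_operator qO vO.
have [D DE] := bounded_combination S T 1.
by exists S, T, D; split=> // x; rewrite DE scale1r.
Qed.

End Unitary.

Lemma glue_operator_inverse V W (p q : nat -> V) (w v : nat -> W)
    (S T D : 'B(V, W)) (S' T' D' : 'B(W, V)) :
    orthonormal_seq p -> orthonormal_seq q -> complete_in (orthocomplement p) q ->
    orthonormal_seq w -> orthonormal_seq v -> (forall i j, inner (w i) (v j) = 0) ->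
    diagonal p w S -> diagonal q v T -> (forall x, D x = S x + T x) ->
    diagonal w p S' -> diagonal v q T' -> (forall x, D' x = S' x + T' x) ->
  forall x, D' (D x) = x.
Proof.
move=> pO qO qC wO vO wv SD TD DE SD' TD' DE' x.
have [P PD] := semi_orthonormal_operator (orthonormal_semi pO) (orthonormal_semi pO).
have [Q QD] := semi_orthonormal_operator (orthonormal_semi qO) (orthonormal_semi qO).
have S'T y : S' (T y) = 0.
  apply: (diagonal_eq0 SD') => n; rewrite (diagonal_inner0 TD) ?scale0r// => k.
  exact: inner_eq0C.
have T'S y : T' (S y) = 0.
  by apply: (diagonal_eq0 TD') => n; rewrite (diagonal_inner0 SD) ?scale0r// => k.
rewrite DE' DE [S' _]linearD [T' _]linearD/= S'T T'S addr0 add0r.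
rewrite (diagonal_compose wO SD SD' PD) (diagonal_compose vO TD TD' QD).
exact: resolution_identity PD QD x.
Qed.

End Completion.

(** * Improving the corner when A is not compact *)

Section Range.
Variable R : realType.

Lemma range_linear_subspace (V W : hilbertType R[i]) (T : 'B(V, W)) :
  linear_subspace (range T).
Proof.
split; first by exists 0; rewrite ?linear0.
by move=> a _ _ [x _ <-] [y _ <-]; exists (a *: x + y); rewrite // linearP.
Qed.

Lemma defect_le (V W : hilbertType R[i]) (T T' : 'B(V, W)) :
  range T `<=` range T' -> (defect T < +oo)%E -> (defect T' < +oo)%E.
Proof.
move=> TT' /quotient_dim_finP[n [e [_ espan]]]; apply/quotient_dim_finP.
apply: (quotient_basis_of_span (e := e)) => //; first exact: range_linear_subspace.
by move=> y _; have [c [/TT' h _]] := espan y I; exists c.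
Qed.

End Range.

Section Corner.
Variables (R : realType) (H K : hilbertType R[i]).
Hypotheses (sepH : separable H) (sepK : separable K).
Hypotheses (infH : vdim [set: H] = +oo%E) (infK : vdim [set: K] = +oo%E).
Variables (A : 'B(H, H)) (B : 'B(K, K)) (D0 : 'B(K, H)).
Let M (D : 'B(K, H)) : 'B(hsum H K, hsum H K) := upper_triangular A B D.
Hypothesis M0_defect : (defect (M D0) < +oo)%E.

(** The second component of the range of M_{D0} is contained in the range of B. *)
Lemma corner_defect : (defect B < +oo)%E.
Proof.
have /quotient_dim_finP[n [e [_ espan]]] := M0_defect; apply/quotient_dim_finP.
apply: (quotient_basis_of_span (e := fun i => (e i).2)) => //.
  exact: range_linear_subspace.
move=> y _; have [c [[x _ xE] _]] := espan ((0, y) : hsum H K) I.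
exists c; exists x.2 => //; rewrite (congr1 snd xE : B x.2 = _) /=.
congr (_ - _).
exact: (@big_morph _ _ (fun z : hsum H K => z.2) 0 +%R 0 +%R).
Qed.

(** The last three clauses pass the properties behind the three spectra on from
    M_{D0}, which has finite defect, to M_D. *)
Definition improves (D : 'B(K, H)) :=
  [/\ Fredholm D, range (M D0) = setT -> range (M D) = setT, (defect (M D) < +oo)%E &
      (0%R%:E <= fredholm_index (M D0))%E -> (0%R%:E <= fredholm_index (M D))%E].

(** D - D0 vanishes on N(B), so it factors as G B, and M_D is the composition of
    M_{D0} with the linear bijection w. *)
Lemma improves_of_agreement (D : 'B(K, H)) : Fredholm D ->
  (forall y, B y = 0 -> D y = D0 y) -> improves D.
Proof.
move=> FD DD0.
have [E EE] := bounded_combination D D0 (-1).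
have [|G Gl GB] := factor_through (E := E) corner_defect.
  by move=> y /DD0 Dy; rewrite EE Dy scaleN1r subrr.
pose w (z : hsum H K) : hsum H K := (z.1 + G z.2, z.2).
pose w' (z : hsum H K) : hsum H K := (z.1 - G z.2, z.2).
have w0 : w 0 = 0.
  by rewrite /w /= -(linear0 B) GB !linear0 addr0.
have wK : cancel w w' by case=> x y; rewrite /w /w' /= addrK.
have w'K : cancel w' w by case=> x y; rewrite /w /w' /= subrK.
have wl : linear w.
  by move=> a x y; rewrite /w /= Gl; congr pair; rewrite /= scalerDr addrACA.
have w'l : linear w'.
  move=> a x y; rewrite /w' /= Gl; congr pair; rewrite /=.
  by rewrite scalerBr opprD addrACA.
have Mw x : M D x = w (M D0 x).
  rewrite /w /M /upper_triangular /= GB EE scaleN1r; congr pair.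
  by rewrite -addrA [D0 _ + _]addrC subrK.
have dM : defect (M D) = defect (M D0) := defect_transport wl w'l wK w'K Mw.
have nM : nullity (M D) = nullity (M D0).
  rewrite /nullity; congr (vdim _); apply/funext => x; apply/propext.
  change (M D x = 0 <-> M D0 x = 0).
  by rewrite Mw; split=> [wx|->//]; apply: (can_inj wK); rewrite wx.
split=> //.
- move=> surj; apply/seteqP; split=> // y _.
  have : range (M D0) (w' y) by rewrite surj.
  by move=> [x _ xE]; exists x => //; rewrite Mw xE w'K.
- by rewrite dM.
- by rewrite /fredholm_index dM nM.
Qed.

(** With q a basis of the complement of N(B) and w a basis of H, the operator
    D = D0 (1 - Q) + U agrees with D0 on N(B) and is onto H, since U maps q to w.
    Its kernel consists of the vectors n - U' (D0 n) with n in N(B). *)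
Lemma improve_finite_kernel (p : nat -> K) m : semi_orthonormal p ->
    complete_in [set y | B y = 0] p -> (forall n, (m <= n)%N -> p n = 0) ->
  exists D, improves D.
Proof.
move=> pS pC pm; have [Bp _] := pC.
have Nl := orthocomplement_linear p.
have [|q qO [qN qC]] := exists_orthonormal_basis sepK Nl.
  move=> s; have [y _ [y0 ys]] := infinite_dim_orth infK (s ++ mkseq p m).
  exists y; last by split=> // v vs; apply: ys; rewrite mem_cat vs.
  move=> n; have [nm|mn] := ltnP n m; last by rewrite pm// inner0r.
  by apply: ys; rewrite mem_cat orbC map_f ?mem_iota.
have [w wO wC] := exists_orthonormal_basis sepH
  (conj I (fun _ _ _ _ _ => I) : linear_subspace setT) (infinite_dim_orth infH).
have qS := orthonormal_semi qO; have wS := orthonormal_semi wO.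
have [P PD] := semi_orthonormal_operator pS pS.
have [Q QD] := semi_orthonormal_operator qS qS.
have [U UD] := semi_orthonormal_operator qS wS.
have [U' U'D] := semi_orthonormal_operator wS qS.
have [W WD] := semi_orthonormal_operator wS wS.
have WE h : W h = h.
  by apply: (projection_id wS WD (N := setT)) => //; split.
have UU' h : U (U' h) = h by rewrite (diagonal_compose qO U'D UD WD).
have U'U y : U' (U y) = Q y by rewrite (diagonal_compose wO UD U'D QD).
have QU' h : Q (U' h) = U' h by rewrite (diagonal_compose qO U'D QD U'D).
have kerq y : B y = 0 -> forall n, inner y (q n) = 0.
  move=> By n; rewrite -(projection_id pS PD (kernel_linear _) (kernel_closed (T := B)) pC By).
  by apply: (diagonal_inner0 PD) => k; apply: inner_eq0C; exact: qN.
have kerQ y : B y = 0 -> Q y = 0.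
  by move=> By; apply: (diagonal_eq0 QD) => n; rewrite kerq ?scale0r.
have kerU y : B y = 0 -> U y = 0.
  by move=> By; apply: (diagonal_eq0 UD) => n; rewrite kerq ?scale0r.
have [d d0 dP] := bounded_map_pos D0; have [d1 d10 d1P] := bounded_map_pos U.
have [d2 d20 d2P] := bounded_map_pos Q.
have [||D DE] := @bounded_linear_pack R K H (fun y => D0 (y - Q y) + U y) (d * (1 + d2) + d1).
- move=> a x y; rewrite [Q _]linearP [U _]linearP/=.
  have -> : a *: x + y - (a *: Q x + Q y) = a *: (x - Q x) + (y - Q y).
    by rewrite opprD addrACA scalerBr.
  by rewrite linearP addrACA -scalerDr.
- move=> y; rewrite (le_trans (ler_normD _ _))// mulrDl lerD//.
  rewrite (le_trans (dP _))// -mulrA ler_pM2l// (le_trans (ler_normB _ _))//.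
  by rewrite mulrDl mul1r lerD2l.
have DD0 y : B y = 0 -> D y = D0 y.
  by move=> By; rewrite DE kerQ// kerU// subr0 addr0.
have DU' h : D (U' h) = h by rewrite DE QU' subrr linear0 add0r UU'.
exists D; apply: improves_of_agreement => //.
apply: (@surjective_finite_kernel_fredholm _ _ _ _ m (fun i => p i - U' (D0 (p i)))).
- by apply/seteqP; split=> // h _; exists (U' h).
- by move=> i; rewrite linearB/= DU' DD0 ?subrr//; exact: Bp.
move=> x Dx; pose y := x - Q x.
have yP : P y = y.
  apply/esym/eqP; rewrite -subr_eq0; apply/eqP; apply: qC => n.
    exact: projection_orth.
  rewrite innerBl (projection_orth qS QD) sub0r (diagonal_inner0 PD) ?oppr0// => k.
  by apply: inner_eq0C; exact: qN.
have yE : y = \sum_(0 <= i < m) inner y (p i) *: p i.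
  by rewrite -[LHS]yP; exact: (diagonal_finite PD).
have xE : x = y - U' (D0 y).
  have : U' (D x) = 0 by rewrite Dx linear0.
  rewrite DE linearD/= U'U -/y => /eqP; rewrite addrC addr_eq0 => /eqP Qx.
  by rewrite -Qx /y subrK.
exists (\row_i inner y (p i)).
have UDy : U' (D0 y) = \sum_(0 <= i < m) inner y (p i) *: U' (D0 (p i)).
  rewrite {1}yE linear_sum/= linear_sum; apply: eq_bigr => i _.
  by rewrite linearZ/= linearZ.
rewrite {1}xE UDy {1}yE -sumrB big_mkord; apply: eq_bigr => i _.
by rewrite mxE scalerBr.
Qed.

(** Notation of the proof: A maps t to the orthonormal sequence u; p and v are the
    even parts of z and u; q and w are bases of the complements of p and v; the
    unitary D = S + T maps p to w by S and q to v by T, and D' = S' + T' is its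
    inverse.  Given (h, B y0), the vector h - D y0 splits into its projection on v,
    which is reached by A through X, and its projection on w, which is reached by D
    from N(B) through S'. *)
Lemma improve_infinite_kernel (z : nat -> K) : orthonormal_seq z ->
  (forall n, B (z n) = 0) -> ~ compact_operator A -> exists D, improves D.
Proof.
move=> zO Bz ncA.
have [x [d [d0 xO Axo Axd]]] := noncompact_orthogonal_seq sepH ncA.
have Ax0 n : 0 < `|A (x n)| by exact: lt_le_trans (Axd n).
pose t n := `|A (x n)|^-1 *: x n.
pose u n := A (t n).
have uO : orthonormal_seq u.
  have uE n : u n = `|A (x n)|^-1 *: A (x n) by rewrite /u /t linearZ.
  split=> [i j ij|n]; rewrite !uE; first by rewrite innerZl innerZr Axo ?mulr0.
  by rewrite normrZ normfV normr_id mulVf// gt_eqF.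
have to : orthogonal_seq t.
  by move=> i j ij; rewrite /t innerZl innerZr xO.1// !mulr0.
have td n : `|t n| <= d^-1.
  by rewrite /t normrZ xO.2 mulr1 normfV normr_id lef_pV2 ?posrE.
have [q qO qC] := half_completion sepK zO.
have [w wO wC] := half_completion sepH uO.
have pO := orthonormal_even zO; have vO := orthonormal_even uO.
set p := fun n => z n.*2 in pO qC; set v := fun n => u n.*2 in vO wC.
have wv i j : inner (w i) (v j) = 0 by exact: wC.1.
have qp i j : inner (q i) (p j) = 0 by exact: qC.1.
have [S [T [D [SD TD DE]]]] := glue_operator pO qO wO vO.
have [S' [T' [D' [SD' TD' DE']]]] := glue_operator wO vO pO qO.
have D'D : forall y, D' (D y) = y.
  exact: (glue_operator_inverse pO qO qC wO vO wv SD TD DE SD' TD' DE').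
have DD' : forall h, D (D' h) = h.
  apply: (glue_operator_inverse vO wO wC qO pO qp TD' SD' _ TD SD).
    by move=> h; rewrite DE' addrC.
  by move=> y; rewrite DE addrC.
have [X XD] : exists X : 'B(H, H), diagonal v (fun n => t n.*2) X.
  apply: (@diagonal_operator _ _ _ _ _ d^-1) => //; first exact: vO.1.
  - by move=> n; rewrite vO.2.
  - by move=> i j ij; apply: to; rewrite (inj_eq double_inj).
have [P PD] := semi_orthonormal_operator (orthonormal_semi vO) (orthonormal_semi vO).
have [Q QD] := semi_orthonormal_operator (orthonormal_semi wO) (orthonormal_semi wO).
have PQ : forall h, P h + Q h = h := resolution_identity vO wO wC PD QD.
have AX h : A (X h) = P h.
  exact: (diagonal_unique (diagonal_comp XD (L := A)) PD).
have BS' h : B (S' h) = 0.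
  apply: (diagonal_eq0 (diagonal_comp SD' (L := B))) => n.
  by rewrite Bz scaler0.
have DS' h : D (S' h) = Q h.
  rewrite DE (diagonal_compose pO SD' SD QD) (diagonal_eq0 TD) ?addr0// => n.
  rewrite (diagonal_inner0 SD') ?scale0r// => k; apply: inner_eq0C; exact: qp.
have rangeM (z' : hsum H K) : range B z'.2 -> range (M D) z'.
  case: z' => h k /= [y0 _ <-]; pose h' := h - D y0.
  exists ((X h', y0 + S' h') : hsum H K) => //.
  rewrite /M /upper_triangular /=; congr pair.
    by rewrite AX [D _]linearD/= DS' addrCA PQ /h' addrC subrK.
  by rewrite [B _]linearD/= BS' addr0.
have range_le : range (M D0) `<=` range (M D).
  by move=> _ [z' _ <-]; apply: rangeM; exists z'.2.
(* the odd terms of u are orthogonal to v, so D' maps them into N(B); hence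
   (- t (2n+1), D' (u (2n+1))) is in the kernel *)
have ker_inf : nullity (M D) = +oo%E.
  pose o n := n.*2.+1.
  have wo n k : inner (u (o n)) (v k) = 0.
    by apply: uO.1; apply/eqP => /(congr1 odd); rewrite /= !odd_double.
  have D'u n : D' (u (o n)) = S' (u (o n)).
    by rewrite DE' (diagonal_eq0 TD') ?addr0// => k; rewrite wo scale0r.
  apply: (@vdim_infinite _ _ _ (fun n => ((- t (o n), D' (u (o n))) : hsum H K))).
    move=> n; rewrite /preimage /= /M /upper_triangular /= DD' linearN/= addrC subrr.
    by rewrite D'u BS'.
  move=> n c /(congr1 (fun z => D z.2)); rewrite linear0.
  rewrite (@big_morph _ _ (fun z : hsum H K => z.2) 0 +%R 0 +%R)//= linear_sum => c0.
  apply: (orthonormal_independent (b := u \o o)).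
    by apply: orthonormal_sub uO => i j [] /double_inj.
  rewrite -[RHS]c0; apply: eq_bigr => i _.
  by rewrite linearZ/= DD'.
have dM := defect_le range_le M0_defect.
exists D; split=> //.
- apply: (@surjective_finite_kernel_fredholm _ _ _ _ 0 (fun=> 0)) => [||y Dy].
  + by apply/seteqP; split=> // h _; exists (D' h).
  + by move=> i; rewrite linear0.
  + by exists 0; rewrite big_ord0 -[LHS]D'D Dy linear0.
- by move=> M0T; apply/seteqP; split=> // y _; apply: range_le; rewrite M0T.
- move=> _; rewrite /fredholm_index ker_inf; move: dM.
  by case: (defect (M D)).
Qed.

(** N(B) is finite-dimensional if and only if its basis p has finitely many nonzero
    terms. *)
Theorem noncompact_corner_improvement : ~ compact_operator A -> exists D, improves D.
Proof.
move=> ncA; have Bl := kernel_linear B.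
have [p pS pC] := exists_basis sepK Bl.
have [[m pm]|inf] := pselect (exists m, forall n, (m <= n)%N -> p n = 0).
  exact: improve_finite_kernel pm.
have [m|z [zO zp _]] := nonzero_enum pS.
  apply: contrapT => no; apply: inf; exists m => n mn.
  by apply/eqP/negP => /negP pn; apply: no; exists n.
apply: (improve_infinite_kernel zO) => // n.
by have [k ->] := zp n; exact: pC.1.
Qed.
End Corner.

(** * The spectra *)

Section RightInverse.
Variable R : realType.
Implicit Types V W : hilbertType R[i].

(** The right inverse maps y to the component orthogonal to the kernel of any
    preimage of y; the open mapping theorem bounds it. *)
Lemma surjective_right_invertible V W (T : 'B(V, W)) : separable V ->
  range T = setT -> right_invertible T.
Proof.
move=> sV Tsurj.
have [p pS pC] := exists_basis sV (kernel_linear T).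
have [P PD] := semi_orthonormal_operator pS pS.
have [M M0 MP] : exists2 M : R[i], 0 < M &
    forall y, exists2 x, T x = y & `|x| <= M * `|y|.
  apply: open_mapping => y; have : range T y by rewrite Tsurj.
  by move=> [x _ xy]; exists x.
have ex y : exists x, T x = y /\ `|x| <= M * `|y|.
  by have [x xy xM] := MP y; exists x.
have [x xP] := boolp.choice ex.
have uniq u v : T u = T v -> u - P u = v - P v.
  move=> uv; apply/eqP; rewrite -subr_eq0; apply/eqP.
  have : P (u - v) = u - v.
    apply: (projection_id pS PD (kernel_linear T) (kernel_closed (T := T)) pC).
    by rewrite /= linearB/= uv subrr.
  rewrite linearB/= opprB [P v - v]addrC addrACA => <-.
  by rewrite addrACA subrr add0r addNr.
have [||S SE] := @bounded_linear_pack R W V (fun y => x y - P (x y)) M.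
- move=> a y z; rewrite (uniq _ (a *: x y + x z)).
    by rewrite linearP opprD addrACA scalerBr.
  by rewrite linearP/= !(xP _).1.
- move=> y; exact: le_trans (projection_rest_le pS PD _) (xP y).2.
exists S => y; rewrite SE linearB/= (xP y).1.
have -> : T (P (x y)) = 0; last by rewrite subr0.
apply: (diagonal_eq0 (diagonal_comp PD (L := T))) => n.
by rewrite (pC.1 n) scaler0.
Qed.

Lemma separable_hsum (H K : hilbertType R[i]) :
  separable H -> separable K -> separable (hsum H K).
Proof.
move=> [D cD dD] [E cE dE].
exists [set z : hsum H K | D z.1 /\ E z.2].
  move: cD cE => /countable_injP[f fi] /countable_injP[g gi].
  apply/countable_injP; exists (fun z => pickle (f z.1, g z.2)).
  move=> [a b] [a' b']; rewrite !inE /= => -[Da Eb] [Da' Eb'].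
  move/(pcan_inj pickleK) => [faa' gbb'].
  by rewrite (fi a a') ?inE// (gi b b') ?inE.
move=> O [z Oz] oO.
have /nbhs_ballP[e /= e0 eO] : nbhs z O by exact: open_nbhs_nbhs.
have e2 : 0 < e / 2 by rewrite divr_gt0.
have [x [zx Dx]] : ball z.1 (e / 2) `&` D !=set0.
  by apply: dD; [exists z.1; exact: ballxx|exact: ball_open].
have [y [zy Ey]] : ball z.2 (e / 2) `&` E !=set0.
  by apply: dE; [exists z.2; exact: ballxx|exact: ball_open].
exists ((x, y) : hsum H K); split=> //; apply: eO.
move: zx zy; rewrite -!ball_normE /= => zx zy.
by rewrite (le_lt_trans (hsum_norm_le _))// (splitr e) ltrD.
Qed.

Lemma eq_fredholm V W (T T' : 'B(V, W)) : T =1 T' ->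
  [/\ range T = range T', defect T = defect T' & fredholm_index T = fredholm_index T'].
Proof.
move=> TT'; have rT : range T = range T' by apply: eq_imagel => x _.
have dT : defect T = defect T' by rewrite /defect rT.
split=> //; rewrite /fredholm_index dT; congr (_ - _)%E.
rewrite /nullity; congr (vdim _); apply/funext => x.
by rewrite /preimage /= TT'.
Qed.

End RightInverse.

(** The three spectra differ only in the property P; what is needed of P is that it
    implies finite defect and passes to operators that are at least as good as
    regards surjectivity, finite defect and nonnegative index. *)
Lemma bigcap_spectrum (R : realType) (H K : hilbertType R[i])
    (sepH : separable H) (sepK : separable K)
    (infH : vdim [set: H] = +oo%E) (infK : vdim [set: K] = +oo%E)
    (A : 'B(H, H)) (B : 'B(K, K)) (P : 'B(hsum H K, hsum H K) -> Prop) :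
    (forall T, P T -> (defect T < +oo)%E) ->
    (forall T T' : 'B(hsum H K, hsum H K), P T ->
      (range T = setT -> range T' = setT) -> (defect T' < +oo)%E ->
      ((0%R%:E <= fredholm_index T)%E -> (0%R%:E <= fredholm_index T')%E) -> P T') ->
  \bigcap_(D in [set D : 'B(K, H) | Fredholm D])
      [set l | ~ P (sub_scalar (upper_triangular A B D) l)] =
  (\bigcap_(D in [set: 'B(K, H)]) [set l | ~ P (sub_scalar (upper_triangular A B D) l)])
    `|` [set l | compact_operator (sub_scalar A l)].
Proof.
move=> Pd Pi.
have shift D l : sub_scalar (upper_triangular A B D) l =1
    upper_triangular (sub_scalar A l) (sub_scalar B l) D.
  move=> z; rewrite /sub_scalar /upper_triangular; congr pair => /=.
  by rewrite addrAC.
have P_eq (T T' : 'B(hsum H K, hsum H K)) : T =1 T' -> P T -> P T'.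
  move=> /eq_fredholm[rT dT iT] PT; apply: (Pi _ _ PT); rewrite -?rT -?dT -?iT//.
  exact: Pd.
apply/seteqP; split=> l.
  move=> lF; have [?|ncA] := pselect (compact_operator (sub_scalar A l)); first by right.
  left=> D0 _ /= PD0.
  have PM : P (upper_triangular (sub_scalar A l) (sub_scalar B l) D0).
    exact: (P_eq _ _ (shift D0 l) PD0).
  have [D [FD rD dD iD]] :=
    noncompact_corner_improvement sepH sepK infH infK (Pd _ PM) ncA.
  apply: (lF D FD); apply: (P_eq _ _ _ (Pi _ _ PM rD dD iD)) => z.
  exact/esym/shift.
move=> [lA D _|lA D FD /= PD]; first exact: lA.
have PM : P (upper_triangular (sub_scalar A l) (sub_scalar B l) D).
  exact: (P_eq _ _ (shift D l) PD).
exact: (compact_corner_not_finite_defect sepK infK lA FD (Pd _ PM)).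
Qed.

Theorem theorem4 (R : realType) (H K : hilbertType R[i])
    (sepH : separable H) (sepK : separable K)
    (infH : vdim [set: H] = +oo%E) (infK : vdim [set: K] = +oo%E)
    (A : 'B(H, H)) (B : 'B(K, K))
    (sigma : 'B(hsum H K, hsum H K) -> set R[i])
    (sigmaP : [set @sigma_r R[i] (hsum H K); @sigma_SFminus R[i] (hsum H K);
                   @sigma_sw R[i] (hsum H K)] sigma) :
  \bigcap_(C in [set C : 'B(K, H) | Fredholm C])
      sigma (upper_triangular A B C) =
  (\bigcap_(C in [set: 'B(K, H)]) sigma (upper_triangular A B C))
    `|` [set lambda | compact_operator (sub_scalar A lambda)].
Proof.
have right_surj (T : 'B(hsum H K, hsum H K)) : right_invertible T -> range T = setT.
  by move=> [S TS]; apply/seteqP; split=> // y _; exists (S y).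
case: sigmaP => [[]|] ->.
- apply: (bigcap_spectrum sepH sepK infH infK A B (P := @right_invertible _ _ _)).
    by move=> T /right_surj; exact: surjective_finite_defect.
  move=> T T' /right_surj rT h _ _.
  by apply: surjective_right_invertible; [exact: separable_hsum|exact: h].
- apply: (bigcap_spectrum sepH sepK infH infK A B (P := @lower_semiFredholm _ _ _)) => //.
- apply: (bigcap_spectrum sepH sepK infH infK A B (P := @lower_semiWeyl _ _ _)) => //.
    by move=> T [].
  by move=> T T' [_ iT] _ dT' ii; split=> //; exact: ii.
Qed.
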